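(* (i) For fixed $m\in\mathbb{N}$, $$\lim_{n\to\infty}P_n^{\text{park}}(\sigma^{-1}_n=n+1-m)=\frac{m^{m-1}e^{-m}}{m!}.$$ Thus, the random variable $n+1-\sigma^{-1}_n$ under $P_n^{\text{park}}$ converges in distribution to a random variable $X$ with the Borel distribution. (ii) For fixed $k\in\mathbb{N}$, $$P_n^{\text{park}}(\sigma^{-1}_n=k)\sim\frac{k^ke^{-k}}{k!}\,\frac1n,\quad\text{as }n\to\infty.$$ (iii) Let $\{c_n\}$ be a sequence such that $c_nn$ is an integer for each $n$ and $\lim_{n\to\infty}c_n=c\in(0,1)$. Then, as $n\to\infty$, $$P_n^{\text{park}}(\sigma^{-1}_n=c_nn)\sim\frac1{(2\pi c)^{\frac12}(1-c)^{\frac32}}\,\frac1{n^{\frac32}}.$$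
   Context: $[n]=\{1,\dots,n\}$ and $S_n$ is the set of permutations $\sigma=\sigma_1\cdots\sigma_n$ of $[n]$; $\sigma^{-1}_k=j$ if and only if $\sigma_j=k$. Parking: cars $1,\dots,n$ arrive in this order on a one-way street with spaces $1,\dots,n$; given a sequence $\pi=(\pi_1,\dots,\pi_n)\in[n]^n$ of preferred spaces, car $i$ parks in space $\pi_i$ if it is free, and otherwise in the first free space with number greater than $\pi_i$, if one exists (if none exists the car exits the street). $\pi$ is a parking function on $[n]$ if all $n$ cars are able to park; $\mathcal{P}_n$ is the set of parking functions on $[n]$. The map $T_n:\mathcal{P}_n\to S_n$ is $T_n(\pi)=\sigma$, where $\sigma_j$ is the number of the car that parked in space $j$, $j\in[n]$. The probability measure $P_n^{\text{park}}$ on $S_n$ is $P_n^{\text{park}}(\sigma)=|T_n^{-1}(\{\sigma\})|/|\mathcal{P}_n|$. The Borel distribution is the probability distribution on $\{1,2,\dots\}$ giving mass $e^{-m}\frac{m^{m-1}}{m!}$ to $m$. $a_n\sim b_n$ means $a_n/b_n\to1$. *)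

(* Defs.v *)
From HB Require Import structures.
From mathcomp Require Import all_boot all_order all_algebra all_fingroup.
From mathcomp Require Import all_classical all_reals all_analysis.

Set Implicit Arguments.
Unset Strict Implicit.
Unset Printing Implicit Defensive.

Import Order.TTheory GRing.Theory Num.Theory.
Import numFieldNormedType.Exports.

Local Open Scope classical_set_scope.
Local Open Scope ring_scope.

(* Cars, spaces and values are elements of 'I_n, hence numbered from 0: the
   element i of 'I_n stands for i + 1 in [n]. *)

Definition street (n : nat) := {ffun 'I_n -> option 'I_n}.

(* The first free space that is not before p. *)
Definition first_free (n : nat) (st : street n) (p : 'I_n) : option 'I_n :=
  [pick j : 'I_n | [&& (p <= j)%N, st j == None &
     [forall l : 'I_n, (p <= l < j)%N ==> (st l != None)]]].

Definition arrive (n : nat) (a : n.-tuple 'I_n) (st : street n) (i : 'I_n) :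
    street n :=
  if first_free st (tnth a i) is Some j
  then [ffun l => if l == j then Some i else st l]
  else st.

(* [enum 'I_n] lists the cars in increasing order. *)
Definition parked (n : nat) (a : n.-tuple 'I_n) : street n :=
  foldl (arrive a) [ffun => None] (enum 'I_n).

Definition is_parking_function (n : nat) (a : n.-tuple 'I_n) : bool :=
  [forall i : 'I_n, exists j : 'I_n, parked a j == Some i].

Definition parking_function (n : nat) :=
  {a : n.-tuple 'I_n | is_parking_function a}.

Lemma parking_function_space (n : nat) (a : parking_function n) (i : 'I_n) :
  exists j : 'I_n, parked (val a) j == Some i.
Proof. by apply/existsP; exact: (forallP (valP a)). Qed.

Definition space_of (n : nat) (a : parking_function n) (i : 'I_n) : 'I_n :=
  xchoose (parking_function_space a i).

Lemma space_ofP (n : nat) (a : parking_function n) (i : 'I_n) :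
  parked (val a) (space_of a i) = Some i.
Proof. exact/eqP/(xchooseP (parking_function_space a i)). Qed.

Lemma space_of_inj (n : nat) (a : parking_function n) :
  injective (space_of a).
Proof.
by move=> i1 i2 e; apply: Some_inj; rewrite -(space_ofP a i1) e space_ofP.
Qed.

(* The permutation whose value at j is the car parked in space j (see
   [parking_permE]): the inverse of the map sending a car to its space. *)
Definition parking_perm (n : nat) (a : parking_function n) : 'S_n :=
  (perm (@space_of_inj n a))^-1%g.

Lemma parking_permE (n : nat) (a : parking_function n) (j : 'I_n) :
  parked (val a) j = Some (parking_perm a j).
Proof.
by rewrite -[j in LHS](permKV (perm (@space_of_inj n a))) permE space_ofP.
Qed.

Lemma parked_id (n : nat) (k : nat) : (k <= n)%N ->
  foldl (arrive [tuple i | i < n]) [ffun => None] (take k (enum 'I_n)) =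
  [ffun j : 'I_n => if (j < k)%N then Some j else None].
Proof.
elim: k => [|k IHk] kn.
  by rewrite take0; apply/ffunP => j; rewrite !ffunE.
pose i := Ordinal kn.
rewrite (take_nth i) ?size_enum_ord// foldl_rcons IHk 1?ltnW//.
have -> : nth i (enum 'I_n) k = i by apply: val_inj; rewrite /= nth_enum_ord.
rewrite /arrive tnth_mktuple /first_free; case: pickP => [j|/(_ i)].
  case/and3P; rewrite ffunE => ij + /forallP/(_ i).
  rewrite leqnn /= ffunE ltnn eqxx implybF -leqNgt => _ ji.
  have -> : j = i by apply/val_inj/anti_leq; rewrite ij ji.
  apply/ffunP => l; rewrite !ffunE [in RHS]ltnS [in RHS]leq_eqVlt.
  by rewrite -[l == k :> nat]/(l == i); case: eqVneq => [->|].
rewrite leqnn ffunE ltnn eqxx /= => /negbT /forallPn[l].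
by rewrite ffunE /=; case: ltnP; rewrite ?implybT//= andbF.
Qed.

Lemma is_parking_function_id (n : nat) :
  is_parking_function [tuple i | i < n].
Proof.
apply/forallP => i; apply/existsP; exists i.
rewrite /parked -[enum _](take_oversize (n := n)) ?size_enum_ord//.
by rewrite parked_id// ffunE ltn_ord.
Qed.

Lemma card_parking_function_gt0 (n : nat) : (0 < #|{: parking_function n}|)%N.
Proof. by apply/card_gt0P; exists (Sub _ (is_parking_function_id n)). Qed.

HB.instance Definition _ (T : finType) := isPointed.Build (perm_type T) (perm_one T).

HB.instance Definition _ (T : finType) :=
  @isMeasurable.Build default_measure_display (perm_type T) discrete_measurable
    discrete_measurable0 discrete_measurableC discrete_measurableU.

Definition park_pmf (R : realType) (n : nat) (s : 'S_n) : R :=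
  #|[set a : parking_function n | parking_perm a == s]%SET|%:R /
  #|{: parking_function n}|%:R.

Lemma park_pmf_ge0 (R : realType) (n : nat) (s : 'S_n) : 0 <= park_pmf R s.
Proof. exact: divr_ge0. Qed.

Lemma park_pmf_sum (R : realType) (n : nat) :
  \sum_(s : 'S_n) park_pmf R s = 1.
Proof.
rewrite -mulr_suml -natr_sum.
rewrite (_ : (\sum_s _)%N = #|{: parking_function n}|) ?mulfV//.
  by rewrite pnatr_eq0 -lt0n card_parking_function_gt0.
rewrite -sum1_card (partition_big (@parking_perm n) predT)//=.
by apply: eq_bigr => s _; rewrite -sum1_card; apply: eq_bigl => a; rewrite inE.
Qed.

Definition park_prob (R : realType) (n : nat) : set 'S_n -> \bar R :=
  fun A => (\sum_(s \in A) (park_pmf R s)%:E)%E.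

Arguments park_prob : clear implicits.

Section park_prob_is_probability.
Context (R : realType) (n : nat).

Let park_prob0 : park_prob R n set0 = 0 :> \bar R.
Proof. by rewrite /park_prob fsbig_set0. Qed.

Let park_prob_ge0 (A : set 'S_n) : (0 <= park_prob R n A)%E.
Proof.
rewrite /park_prob fsbig_finite//= sumEFin lee_fin.
by apply: sumr_ge0 => s _; exact: park_pmf_ge0.
Qed.

Let park_prob_sigma_additive : semi_sigma_additive (park_prob R n).
Proof.
move=> F mF tF mUF; rewrite /park_prob; apply: cvg_toP.
  apply: ereal_nondecreasing_is_cvgn => a b ab.
  by apply: lee_sum_nneg_natr => // k _ _; exact: park_prob_ge0.
transitivity (\sum_(0 <= i <oo) (\esum_(s in F i) (park_pmf R s)%:E))%E.
  by apply: eq_eseriesr => k _; rewrite esum_fset//= => s _;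
    rewrite lee_fin park_pmf_ge0.
rewrite -nneseries_sum_bigcup//=; last first.
  by move=> s; rewrite lee_fin park_pmf_ge0.
by rewrite esum_fset//= => s _; rewrite lee_fin park_pmf_ge0.
Qed.

HB.instance Definition _ := isMeasure.Build _ _ _ (park_prob R n)
  park_prob0 park_prob_ge0 park_prob_sigma_additive.

Let park_prob_setT : park_prob R n [set: 'S_n] = 1%E.
Proof.
rewrite -(park_pmf_sum R n) -sumEFin /park_prob.
rewrite (_ : [set: 'S_n] = [set` index_enum [the finType of 'S_n]]).
  by rewrite -fsbig_seq// index_enum_uniq.
by apply/seteqP; split => s //= _; rewrite mem_index_enum.
Qed.

HB.instance Definition _ :=
  @Measure_isProbability.Build _ _ R (park_prob R n) park_prob_setT.

End park_prob_is_probability.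

(* The position, in {1, ..., n}, of the largest value n of the permutation
   s_1 ... s_n; the value for n = 0 is junk. *)
Definition last_pos (n : nat) : 'S_n -> nat :=
  match n return 'S_n -> nat with
  | 0 => fun _ => 0%N
  | n'.+1 => fun s => (s^-1%g ord_max).+1
  end.

(* n + 1 - last_pos s, as a real random variable. *)
Definition last_pos_rev (R : realType) (n : nat) (s : 'S_n) : R :=
  n.+1%:R - (last_pos s)%:R.

Lemma measurable_last_pos_rev (R : realType) (n : nat) :
  measurable_fun [set: 'S_n] (@last_pos_rev R n).
Proof. by []. Qed.

HB.instance Definition _ (R : realType) (n : nat) :=
  isMeasurableFun.Build _ _ _ _ (@last_pos_rev R n)
    (@measurable_last_pos_rev R n).

Definition last_pos_rev_RV (R : realType) (n : nat) :
    {RV (park_prob R n) >-> R} :=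
  @last_pos_rev R n.

Definition has_borel_distribution (R : realType) (d : measure_display)
    (Om : measurableType d) (P : probability Om R) (X : {RV P >-> R}) : Prop :=
  P (X @^-1` [set m%:R | m in [set m : nat | (0 < m)%N]]) = 1%E /\
  forall m : nat, (0 < m)%N ->
    P (X @^-1` [set m%:R]) = (expR (- m%:R) * (m%:R ^+ m.-1 / m`!%:R))%:E.

Definition cvg_in_distribution (R : realType)
    (d : nat -> measure_display) (Om : forall n, measurableType (d n))
    (P : forall n, probability (Om n) R) (X : forall n, {RV (P n) >-> R})
    (d' : measure_display) (Om' : measurableType d')
    (P' : probability Om' R) (X' : {RV P' >-> R}) : Prop :=
  forall x : R, {for x, continuous (cdf X')} ->
    cdf (X n) x @[n --> \oo] --> cdf X' x.

Definition asymp_equiv (R : realType) (a b : nat -> R) : Prop :=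
  a n / b n @[n --> \oo] --> (1 : R).

(* Main.v *)
Require Import Defs.
From HB Require Import structures.
From mathcomp Require Import all_boot all_order all_algebra all_fingroup.
From mathcomp Require Import all_classical all_reals all_analysis.
From mathcomp Require Import zify ring lra.

Set Implicit Arguments.
Unset Strict Implicit.
Unset Printing Implicit Defensive.

Import Order.TTheory GRing.Theory Num.Theory.
Import numFieldNormedType.Exports.

Local Open Scope ring_scope.

(** Why the theorem holds. The last of n cars ends in space k exactly when the
    first n - 1 cars fill every space but k and its own preference is one of
    1, ..., k. Cars on the two sides of the empty space k do not interact, so
    the first event splits into two smaller parking problems, interleaved in
    C(n - 1, k - 1) ways. Since there are (l + 1)^(l - 1) parking functions of
    length l,

      P_n(k) = C(n - 1, k - 1) k^(k - 1) (n - k + 1)^(n - k - 1)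
               / (n + 1)^(n - 1).

    The enumeration itself comes from the same decomposition according to the
    space of the last car ([fillingsS], [fillings_setU]), solved by Abel's
    identity ([abel_identity], [fillings_block]).

    Write u_k = k^k e^(-k) / k! ([poisson_diag]) and m = n + 1 - k. The powers
    of e cancel, and the formula becomes ([park_prob_poisson_diag])

      P_n(k) = (u_k u_m / u_(n+1)) (n + 1) / (n m).

    The bounds (1 + 1/k)^k <= e <= (1 + 1/k)^(k+1) make u_k decreasing and
    k u_k increasing, so u_(k+j) / u_k tends to 1 for fixed j. Fixing m gives
    P_n(n + 1 - m) -> u_m / m, the Borel mass function; fixing k gives
    n P_n(k) -> u_k. When k grows linearly, Stirling's formula in the form
    k u_k^2 -> 1 / (2 pi) ([stirling_seq_cvg]) turns the three factors u into
    square roots. Stirling's formula is obtained from the monotonicity of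
    k u_k^2 and from Wallis' product, which evaluates the limit.

    For the convergence in distribution, the limit masses b_m = u_m / m have to
    sum to 1. That the P_n(k) sum to 1 over k is the renewal equation
    u_N = sum_(m <= N) b_m u_(N-m) ([renewal]); as the sum of the u_N diverges,
    the renewal process is recurrent, which means that the b_m sum to 1
    ([borel_pmf_sum_cvg1]). All variables are integer-valued, so each
    distribution function is a finite sum of point masses and converges. *)

(** * Parking as a process on sets of occupied spaces *)

Definition free_at n (U : {set 'I_n}) (p j : 'I_n) : bool :=
  [&& (p <= j)%N, j \notin U & [forall l : 'I_n, (p <= l < j)%N ==> (l \in U)]].

(** Which car stands in an occupied space has no influence on later cars, so
    the street is reduced to its set of occupied spaces. *)
Definition park_one n (U : {set 'I_n}) (p : 'I_n) : {set 'I_n} :=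
  if [pick j | free_at U p j] is Some j then (j |: U)%SET else U.

Definition filled n (s : seq 'I_n) : {set 'I_n} := foldl (@park_one n) finset.set0 s.

Definition fillings n (m : nat) (U : {set 'I_n}) : nat :=
  #|[set t : m.-tuple 'I_n | filled t == U]%SET|.

(** The number of preferences that send a car to k when the rest of U is
    occupied and k is free (see [park_one_eq]). *)
Definition run_length n (U : {set 'I_n}) (k : 'I_n) : nat :=
  #|[set p : 'I_n | (p <= k)%N & [forall l : 'I_n, (p <= l < k)%N ==> (l \in U)]]%SET|.

Lemma free_at_uniq n (U : {set 'I_n}) (p j j' : 'I_n) :
  free_at U p j -> free_at U p j' -> j = j'.
Proof.
move=> /and3P[pj jU /forallP aj] /and3P[pj' j'U /forallP aj'].
apply: val_inj; apply/eqP; rewrite eqn_leq; apply/andP; split;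
  rewrite leqNgt; apply/negP => lt.
  by move: (aj j'); rewrite pj' lt /= (negbTE j'U).
by move: (aj' j); rewrite pj lt /= (negbTE jU).
Qed.

Lemma pick_free_at n (U : {set 'I_n}) (p k : 'I_n) :
  ([pick j | free_at U p j] == Some k) = free_at U p k.
Proof.
case: pickP => [j fj|nf]; last by rewrite nf.
by apply/eqP/idP => [[<-]//|fk]; congr Some; exact: free_at_uniq fj fk.
Qed.

Lemma park_one_eq n (U : {set 'I_n}) (p k : 'I_n) : k \in U ->
  (park_one (U :\ k)%SET p == U) =
  ((p <= k)%N && [forall l : 'I_n, (p <= l < k)%N ==> (l \in U)]).
Proof.
move=> kU.
have -> : (p <= k)%N && [forall l : 'I_n, (p <= l < k)%N ==> (l \in U)] =
    free_at (U :\ k)%SET p k.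
  rewrite /free_at !inE eqxx /=; congr andb; apply: eq_forallb => l.
  rewrite !inE; case: (eqVneq l k) => [->|//]; by rewrite ltnn andbF.
rewrite -pick_free_at /park_one; case: pickP => [j fj|nf].
  apply/eqP/eqP => [e|[->]]; last exact: finset.setD1K.
  congr Some; apply/eqP; move/finset.setP/(_ k): e; rewrite !inE kU eqxx orbF.
  by rewrite eq_sym.
by apply/negbTE/eqP => /finset.setP/(_ k); rewrite !inE kU eqxx.
Qed.

Lemma park_one_cases n (U : {set 'I_n}) (p : 'I_n) :
  park_one U p = U \/ exists2 k, k \notin U & park_one U p = (k |: U)%SET.
Proof.
rewrite /park_one; case: pickP => [j /and3P[_ jU _]|]; last by left.
by right; exists j.
Qed.

(** It follows that m cars which fill m spaces all park; in particular the last
    of them takes a new space, by which [fillingsS] sorts. *)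
Lemma card_filled n (s : seq 'I_n) : (#|filled s| <= size s)%N.
Proof.
elim/last_ind: s => [|s p IH]; first by rewrite cards0.
rewrite /filled foldl_rcons size_rcons -/(filled s).
case: (park_one_cases (filled s) p) => [->|[k kU ->]]; first exact: leqW.
by rewrite cardsU1 kU.
Qed.

Lemma filled_rcons n (s : seq 'I_n) p :
  filled (rcons s p) = park_one (filled s) p.
Proof. by rewrite /filled foldl_rcons. Qed.

Lemma card_rcons_tuple (T : finType) m (P : {set m.-tuple T * T})
    (Q : {set m.+1.-tuple T}) :
  (forall (t : m.-tuple T) p, ([tuple of rcons t p] \in Q) = ((t, p) \in P)) -> #|Q| = #|P|.
Proof.
move=> QP; pose f (tp : m.-tuple T * T) := [tuple of rcons tp.1 tp.2].
have f_inj : injective f.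
  move=> [t p] [t' p'] /(congr1 val) /= /rcons_inj [] tt' ->.
  by congr pair; exact: val_inj.
rewrite -(card_imset _ f_inj); apply: eq_card => t.
apply/idP/imsetP => [Qt|[[t' p] Pt ->]]; last by rewrite QP.
case/lastP E: (tval t) => [|s p]; first by have := size_tuple t; rewrite E.
have sm : size s == m by have := size_tuple t; rewrite E size_rcons => -[->].
have et : t = f (Tuple sm, p) by exact: val_inj.
by exists (Tuple sm, p) => //; rewrite -QP; move: Qt; rewrite et.
Qed.

(** The last car lands in k, given that the others fill the rest of U, for
    [run_length U k] of its preferences, independently of the other cars. *)
Lemma card_filled_last n m (U : {set 'I_n}) (k : 'I_n) : k \in U ->
  #|[set t : m.+1.-tuple 'I_n |
      (filled t == U) && (filled (take m t) == (U :\ k)%SET)]%SET| =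
  (run_length U k * fillings m (U :\ k)%SET)%N.
Proof.
move=> kU; rewrite mulnC -cardsX; apply: card_rcons_tuple => t p.
rewrite !inE /= filled_rcons -cats1 take_size_cat ?size_tuple// andbC.
case: eqP => //= ->; exact: park_one_eq.
Qed.

(** The lists that fill U are sorted by the space that the last car takes. *)
Lemma fillingsS n m (U : {set 'I_n}) : #|U| = m.+1 ->
  fillings m.+1 U = (\sum_(k in U) run_length U k * fillings m (U :\ k)%SET)%N.
Proof.
move=> Um; under eq_bigr => k kU do rewrite -card_filled_last//.
rewrite /fillings -sum1_card.
under [RHS]eq_bigr => k kU do rewrite -sum1_card.
under [RHS]eq_bigr => k kU do under eq_bigl => t do rewrite inE.
rewrite (exchange_big_dep (fun t : m.+1.-tuple 'I_n => filled t == U)) /=; last first.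
  by move=> k t _ /andP[].
under [LHS]eq_bigl => t do rewrite inE.
apply: eq_bigr => t /eqP ft.
have [s [p [et sm]]] : exists s p, tval t = rcons s p /\ size s = m.
  case/lastP E: (tval t) => [|s p]; first by have := size_tuple t; rewrite E.
  by exists s, p; split=> //; have := size_tuple t; rewrite E size_rcons => -[].
have tk : take m t = s by rewrite et -cats1 take_size_cat.
rewrite tk; move: ft; rewrite et filled_rcons => fU; rewrite fU eqxx /=.
have cs := card_filled s.
case: (park_one_cases (filled s) p) => [e|[k kU e]].
  by move: cs; rewrite -e fU Um sm ltnn.
rewrite (big_pred1 k)// => j /=; rewrite -fU e !inE.
apply/andP/eqP => [[jU /eqP E]|->]; last by rewrite eqxx /= setU1K.
case/orP: jU => [/eqP//|js]; move/finset.setP/(_ j): E.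
by rewrite !inE eqxx js.
Qed.

(** * Abel's identity *)

(** An m-th finite difference of a polynomial of degree less than m. The
    induction on the degree uses (k + x)^(d+1) = k (k + x)^d + x (k + x)^d
    and k C(m, k) = m C(m - 1, k - 1), which lowers m and d together. *)
Lemma alternating_binomial_power (m d x : nat) : (d < m)%N ->
  \sum_(k < m.+1) (-1) ^+ (m - k) * 'C(m, k)%:R * (k + x)%N%:R ^+ d = 0 :> int.
Proof.
elim: d m x => [|d IH] m x dm.
  under eq_bigr => k _ do rewrite expr0 mulr1.
  transitivity ((-1 + 1 : int) ^+ m); last by rewrite addNr expr0n; case: m dm.
  by rewrite exprDn; apply: eq_bigr => k _; rewrite expr1n mulr1 mulr_natr.
case: m dm => // m dm.
transitivity (m.+1%:R * (\sum_(k < m.+1)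
      (-1) ^+ (m - k) * 'C(m, k)%:R * (k + x.+1)%N%:R ^+ d)
   + x%:R * (\sum_(k < m.+2)
      (-1) ^+ (m.+1 - k) * 'C(m.+1, k)%:R * (k + x)%N%:R ^+ d) : int);
  last first.
  by rewrite !IH ?mulr0 ?addr0//; lia.
rewrite !mulr_sumr [X in _ = X + _](_ : _ =
  \sum_(k < m.+2) (-1) ^+ (m.+1 - k) * (k * 'C(m.+1, k))%N%:R * (k + x)%N%:R ^+ d).
  rewrite -big_split; apply: eq_bigr => k _ /=; rewrite exprSr natrD natrM; ring.
rewrite [RHS]big_ord_recl /= mul0n mulr0 mul0r add0r; apply: eq_bigr => k _.
rewrite /bump /= add1n subSS addSnnS -mul_bin_diag natrM; ring.
Qed.

Lemma trinomial_symmetry (l k m : nat) : (k <= m)%N -> (m <= l)%N ->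
  ('C(l, k) * 'C(l - k, m - k) = 'C(l, m) * 'C(m, k))%N.
Proof.
move=> km ml.
have f0 : (0 < k`! * (m - k)`! * (l - m)`!)%N by rewrite !muln_gt0 !fact_gt0.
apply/eqP; rewrite -(eqn_pmul2r f0); apply/eqP.
have e1 := @bin_fact l k (leq_trans km ml).
have e2 := @bin_fact (l - k) (m - k) (leq_sub2r k ml).
have e3 := bin_fact ml; have e4 := bin_fact km.
have e : (l - k - (m - k) = l - m)%N by lia.
rewrite e in e2.
transitivity l`!; first by rewrite -e1 -e2; ring.
by rewrite -e3 -e4; ring.
Qed.

(** After the reversal i = l - k of the sum, the factor (l - k + 1)^(l - k) is
    expanded as (Y - (k + 1))^(l - k) with Y = l + 2. The coefficient of
    Y^(l - m) is then an m-th finite difference of (k + 1)^(m - 1), which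
    vanishes unless m = 0. *)
Lemma abel_identity (l : nat) :
  (\sum_(i < l.+1) 'C(l, i) * (i.+1 ^ i * (l - i).+1 ^ (l - i).-1) = l.+2 ^ l)%N.
Proof.
apply/eqP; rewrite -(eqr_nat int) natr_sum natrX; apply/eqP.
rewrite (reindex_inj rev_ord_inj) /=.
transitivity (\sum_(k < l.+1) \sum_(m < l.+1 | (k <= m)%N)
   'C(l, m)%:R * l.+2%:R ^+ (l - m) *
   ((-1) ^+ (m - k) * 'C(m, k)%:R * (k + 1)%N%:R ^+ m.-1) : int).
  apply: eq_bigr => k _; have kl : (k <= l)%N by rewrite -ltnS.
  rewrite subSS subKn// bin_sub// natrM natrM !natrX.
  rewrite (_ : (l - k).+1%:R = l.+2%:R + - k.+1%:R :> int); last first.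
    by rewrite -natrB ?subSS ?subSn// ltnW// !ltnS.
  rewrite exprDn mulr_suml mulr_sumr.
  pose G m : int := 'C(l, m)%:R * l.+2%:R ^+ (l - m) *
    ((-1) ^+ (m - k) * 'C(m, k)%:R * (k + 1)%N%:R ^+ m.-1).
  rewrite -[RHS]/(\sum_(m < l.+1 | (k <= m)%N) G m).
  rewrite -(big_geq_mkord k l.+1 xpredT G) -[in RHS](add0n (nat_of_ord k))
    big_addn subSn// big_mkord.
  apply: eq_bigr => j _; rewrite /G; have jl : (j + k <= l)%N by have := ltn_ord j; lia.
  rewrite addnK (_ : (l - (j + k) = l - k - j)%N); last by lia.
  have t := @trinomial_symmetry l k (j + k) (leq_addl _ _) jl.
  rewrite addnK in t.
  rewrite (exprNn k.+1%:R).
  have -> : (k + 1)%N%:R ^+ (j + k).-1 = k.+1%:R ^+ j * k.+1%:R ^+ k.-1 :> int.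
    rewrite addn1; move: (nat_of_ord j) => i; case: (nat_of_ord k) => [|k0] /=.
      by rewrite !expr1n mulr1.
    by rewrite addnS exprD.
  move/(congr1 (fun n => n%:R : int)): t; rewrite !natrM => t.
  transitivity (('C(l, k)%:R * 'C(l - k, j)%:R : int) * (l.+2%:R ^+ (l - k - j) *
     ((-1) ^+ j * k.+1%:R ^+ j) * k.+1%:R ^+ k.-1)); first by ring.
  rewrite t; ring.
rewrite (exchange_big_dep predT)//=.
rewrite big_ord_recl /= [X in _ + X]big1 ?addr0.
  rewrite (big_pred1 ord0) => [|k]; last by rewrite /= leqn0.
  by rewrite /= !bin0 subn0 !expr0 mulr1n !mulr1 mul1r.
move=> m _; rewrite -mulr_sumr.
set M := lift ord0 m; have mM : (M = m.+1 :> nat) by [].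
have Ml : (M < l.+1)%N by exact: ltn_ord.
transitivity ('C(l, M)%:R * l.+2%:R ^+ (l - M) * (\sum_(k < M.+1)
   (-1) ^+ (M - k) * 'C(M, k)%:R * (k + 1)%N%:R ^+ M.-1) : int); last first.
  by rewrite alternating_binomial_power ?mulr0// mM.
congr (_ * _).
by rewrite (big_ord_widen l.+1 (fun k =>
  (-1) ^+ (M - k) * 'C(M, k)%:R * (k + 1)%N%:R ^+ M.-1 : int)).
Qed.

(** * Counting the ways to fill a block *)

Lemma fillings0 n : fillings 0 (@finset.set0 'I_n) = 1%N.
Proof.
rewrite /fillings (_ : [set t | _]%SET = finset.setT) ?cardsT ?card_tuple ?expn0//.
by apply/finset.setP => t; rewrite !inE tuple0 eqxx.
Qed.

(** A run of occupied spaces cannot cross the free space g, so adding occupied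
    spaces on the other side of g does not change it. *)
Lemma run_length_setU_below n (U V : {set 'I_n}) (g : nat) (k : 'I_n) :
  (forall x, x \in U -> (x < g)%N) -> (forall x, x \in V -> (g < x)%N) ->
  k \in U -> run_length (U :|: V)%SET k = run_length U k.
Proof.
move=> Ug Vg kU; rewrite /run_length; apply: eq_card => p; rewrite !inE.
congr andb; apply: eq_forallb => l; case: (boolP (p <= l < k)%N) => //= /andP[_ lk].
rewrite inE; case: (boolP (l \in V)) => [/Vg gl|]; last by rewrite orbF.
by have := Ug _ kU; lia.
Qed.

Lemma run_length_setU_above n (U V : {set 'I_n}) (g : nat) (k : 'I_n) :
  (forall x, x \in U -> (x < g)%N) -> (forall x, x \in V -> (g < x)%N) ->
  k \in V -> run_length (U :|: V)%SET k = run_length V k.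
Proof.
move=> Ug Vg kV; rewrite /run_length; apply: eq_card => p; rewrite !inE.
case: (leqP p k) => //= pk; apply/forallP/forallP => H l; have := H l;
  case: (boolP (p <= l < k)%N) => //= /andP[pl lk].
  rewrite inE; case: (boolP (l \in U)) => //= /Ug lg _.
  have gn : (g < n)%N := ltn_trans (Vg _ kV) (ltn_ord k).
  (* A run that reaches down into U would contain the free space g. *)
  have := H (Ordinal gn); rewrite /= (Vg _ kV) inE.
  have -> /= : (p <= g)%N by lia.
  by case/orP => [/Ug|/Vg]; rewrite /= ltnn.
by rewrite inE => ->; rewrite orbT.
Qed.

(** Cars that fill U and cars that fill V do not interact when a space g between
    them stays free; the binomial coefficient counts the interleavings. The
    induction on the last car matches Pascal's rule: that car is in U or in
    V. *)
Lemma fillings_setU n (U V : {set 'I_n}) (g u v : nat) :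
  (forall x, x \in U -> (x < g)%N) -> (forall x, x \in V -> (g < x)%N) ->
  #|U| = u -> #|V| = v ->
  fillings (u + v) (U :|: V)%SET = ('C(u + v, u) * (fillings u U * fillings v V))%N.
Proof.
have [m] := ubnP (u + v); elim: m U V u v => // m IH U V u v.
case: u => [|u] uvm Ug Vg Uu Vv.
  move/cards0_eq: Uu => ->; by rewrite finset.set0U add0n bin0 fillings0 !mul1n.
case: v => [|v] in uvm Vv *.
  move/cards0_eq: Vv => ->; by rewrite finset.setU0 addn0 binn fillings0 mul1n muln1.
have dUV : [disjoint U & V].
  rewrite disjoint_subset; apply/fintype.subsetP => x xU; rewrite inE.
  by apply/negP => /Vg; have := Ug _ xU; lia.
have cUV : #|(U :|: V)%SET| = (u + v.+1).+1.
  by move/leqifP: (leq_card_setU U V); rewrite dUV Uu Vv => /eqP.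
rewrite addSn fillingsS// (eq_bigl _ _ (fun k => finset.in_setU k U V)) bigU//=.
have subU k x : x \in (U :\ k)%SET -> (x < g)%N by rewrite inE => /andP[_ /Ug].
have subV k x : x \in (V :\ k)%SET -> (g < x)%N by rewrite inE => /andP[_ /Vg].
have -> : (\sum_(k in U) run_length (U :|: V) k * fillings (u + v.+1) ((U :|: V) :\ k)%SET =
    'C(u + v.+1, u) * (fillings u.+1 U * fillings v.+1 V))%N.
  rewrite (fillingsS Uu) mulnA big_distrr big_distrl; apply: eq_bigr => k kU /=.
  rewrite (run_length_setU_below Ug Vg kU).
  have -> : ((U :|: V) :\ k)%SET = ((U :\ k) :|: V)%SET.
    rewrite finset.setDUl (_ : (V :\ k = V)%SET)//; apply/finset.setDidPl.
    by rewrite disjoint_sym disjoints1; apply/negP => /Vg; have := Ug _ kU; lia.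
  rewrite (IH _ _ u v.+1)//; first by ring.
  - exact: subU.
  - by move: (cardsD1 k U); rewrite kU Uu add1n => -[].
have -> : (\sum_(k in V) run_length (U :|: V) k * fillings (u + v.+1) ((U :|: V) :\ k)%SET =
    'C(u + v.+1, u.+1) * (fillings u.+1 U * fillings v.+1 V))%N.
  rewrite (fillingsS Vv) mulnA big_distrr; apply: eq_bigr => k kV /=.
  rewrite (run_length_setU_above Ug Vg kV).
  have -> : ((U :|: V) :\ k)%SET = (U :|: (V :\ k))%SET.
    rewrite finset.setDUl (_ : (U :\ k = U)%SET)//; apply/finset.setDidPl.
    by rewrite disjoint_sym disjoints1; apply/negP => /Ug; have := Vg _ kV; lia.
  rewrite addnS -addSn (IH _ _ u.+1 v)//; first by ring.
  - by rewrite addSn -addnS.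
  - exact: subV.
  - by move: (cardsD1 k V); rewrite kV Vv add1n => -[].
by rewrite -mulnDl binS addnC.
Qed.

Definition block n (a l : nat) : {set 'I_n} := [set x : 'I_n | (a <= x < a + l)%N]%SET.

Lemma card_block n a l : (a + l <= n)%N -> #|block n a l| = l.
Proof.
elim: l => [|l IH] aln.
  by apply/eqP; rewrite cards_eq0; apply/eqP/finset.setP => x; rewrite !inE; lia.
have an : (a + l < n)%N by lia.
rewrite (_ : block n a l.+1 = Ordinal an |: block n a l)%SET.
  by rewrite cardsU1 IH ?inE /=; lia.
apply/finset.setP => x; rewrite !inE -(inj_eq val_inj) /=; lia.
Qed.

Lemma run_length_block n a l (k : 'I_n) : k \in block n a l ->
  run_length (block n a l) k = (k - a).+1.
Proof.
rewrite inE => /andP[ak kl].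
have le : (a + (k - a).+1 <= n)%N by have := ltn_ord k; lia.
rewrite -[RHS](card_block le); apply: eq_card => p; rewrite !inE.
apply/idP/idP => [/andP[pk /forallP H]|H].
  apply/andP; split; last by lia.
  rewrite leqNgt; apply/negP => pa; have := H p; rewrite leqnn /= inE; lia.
apply/andP; split; first by lia.
by apply/forallP => x; apply/implyP; rewrite inE; lia.
Qed.

Lemma block_rem n a l (k : 'I_n) : k \in block n a l.+1 ->
  (block n a l.+1 :\ k = block n a (k - a) :|: block n k.+1 (l - (k - a)))%SET.
Proof.
rewrite inE => /andP[ak kl]; apply/finset.setP => x.
rewrite !inE -(inj_eq val_inj) /=; lia.
Qed.

Lemma fillings_block_rem n a l (k : 'I_n) : (a + l.+1 <= n)%N -> k \in block n a l.+1 ->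
  fillings l (block n a l.+1 :\ k)%SET = ('C(l, k - a) *
   (fillings (k - a) (block n a (k - a)) *
    fillings (l - (k - a)) (block n k.+1 (l - (k - a)))))%N.
Proof.
move=> aln kb; rewrite block_rem//; move: kb; rewrite inE => /andP[ak kl].
have kal : (k - a <= l)%N by lia.
have := @fillings_setU n (block n a (k - a)) (block n k.+1 (l - (k - a))) k
  (k - a) (l - (k - a)).
rewrite (subnKC kal); apply.
- by move=> x; rewrite inE; lia.
- by move=> x; rewrite inE; lia.
- by apply: card_block; lia.
- by apply: card_block; lia.
Qed.

Lemma sum_block n a l (F : nat -> nat) : (a + l <= n)%N ->
  (\sum_(k in block n a l) F (k - a) = \sum_(i < l) F i)%N.
Proof.
elim: l => [|l IH] aln.
  rewrite big_ord0 big_pred0// => x; rewrite inE; lia.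
have an : (a + l < n)%N by lia.
rewrite (bigD1 (Ordinal an)) /=; last by rewrite inE /=; lia.
rewrite big_ord_recr /= addnC addKn -IH; last by lia.
congr addn; apply: eq_bigl => x; rewrite !inE -(inj_eq val_inj) /=; lia.
Qed.

(** Removing the space of the last car cuts the block in two smaller blocks;
    the resulting recursion is solved by Abel's identity. *)
Lemma fillings_block n a l : (a + l <= n)%N ->
  fillings l (block n a l) = (l.+1 ^ l.-1)%N.
Proof.
have [m] := ubnP l; elim: m a l => // m IH a [|l] lm aln.
  rewrite (_ : block n a 0 = finset.set0) ?fillings0//.
  by apply/finset.setP => x; rewrite !inE; lia.
rewrite fillingsS ?card_block// -[RHS]abel_identity.
rewrite -(@sum_block n a l.+1 (fun i => 'C(l, i) * (i.+1 ^ i * (l - i).+1 ^ (l - i).-1))%N)//.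
apply: eq_bigr => k kb; rewrite run_length_block// fillings_block_rem//.
move: kb; rewrite inE => /andP[ak kl].
rewrite !IH//; try lia.
by case: (k - a)%N => [|i] /=; rewrite ?expnS; ring.
Qed.

Lemma fillings_remove n (k : 'I_n.+1) :
  fillings n (finset.setT :\ k)%SET =
  ('C(n, k) * (k.+1 ^ k.-1 * (n - k).+1 ^ (n - k).-1))%N.
Proof.
have e : finset.setT = block n.+1 0 n.+1 by apply/finset.setP => x;
  rewrite !inE /= add0n ltn_ord.
rewrite e fillings_block_rem// -?e ?inE// subn0 !fillings_block//;
  have := ltn_ord k; lia.
Qed.

Lemma fillings_setT n : fillings n ([set: 'I_n]%SET) = (n.+1 ^ n.-1)%N.
Proof.
have -> : finset.setT = block n 0 n by apply/finset.setP => x;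
  rewrite !inE /= add0n ltn_ord.
exact: fillings_block.
Qed.

Lemma run_length_setT n (k : 'I_n) : run_length ([set: 'I_n]%SET) k = k.+1.
Proof.
have -> : finset.setT = block n 0 n by apply/finset.setP => x;
  rewrite !inE /= add0n ltn_ord.
by rewrite run_length_block ?subn0// inE /= add0n.
Qed.

(** * The law of the space of the last car *)

Definition occupied n (st : street n) : {set 'I_n} :=
  [set j | st j != None]%SET.

Lemma first_freeE n (st : street n) (p : 'I_n) :
  first_free st p = [pick j | free_at (occupied st) p j].
Proof.
apply: eq_pick => j; rewrite /free_at !inE negbK; congr [&& _, _ & _].
by apply: eq_forallb => l; rewrite inE.
Qed.

Lemma occupied_arrive n (a : n.-tuple 'I_n) (st : street n) (i : 'I_n) :
  occupied (arrive a st i) = park_one (occupied st) (tnth a i).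
Proof.
rewrite /arrive /park_one first_freeE; case: pickP => // j _.
by apply/finset.setP => l; rewrite !inE ffunE; case: (l == j).
Qed.

Definition street_after n (a : n.-tuple 'I_n) (s : seq 'I_n) : street n :=
  foldl (arrive a) [ffun => None] s.

Lemma occupied_street_after n (a : n.-tuple 'I_n) (s : seq 'I_n) :
  occupied (street_after a s) = filled (map (tnth a) s).
Proof.
elim/last_ind: s => [|s i IH].
  by apply/finset.setP => l; rewrite !inE ffunE eqxx.
by rewrite /street_after foldl_rcons occupied_arrive IH map_rcons filled_rcons.
Qed.

(** The street with its cars moves along with the set of occupied spaces: the
    new car goes to the first free space of that set. *)
Lemma street_after_rcons n (a : n.-tuple 'I_n) (s : seq 'I_n) (i j : 'I_n) :
  street_after a (rcons s i) j =
  if [pick j | free_at (occupied (street_after a s)) (tnth a i) j] == Some j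
  then Some i else street_after a s j.
Proof.
rewrite /street_after foldl_rcons -/(street_after a s) /arrive first_freeE.
case: pickP => // k _; rewrite ffunE; have [->|jk] := eqVneq j k.
  by rewrite eqxx.
by case: eqP => // -[] kj; rewrite kj eqxx in jk.
Qed.

Lemma street_after_mem n (a : n.-tuple 'I_n) (s : seq 'I_n) (j c : 'I_n) :
  street_after a s j = Some c -> c \in s.
Proof.
elim/last_ind: s => [|s i IH]; first by rewrite /street_after /= ffunE.
rewrite street_after_rcons mem_rcons in_cons; case: ifP => _ => [[->]|/IH ->].
  by rewrite eqxx.
by rewrite orbT.
Qed.

Lemma street_after_inj n (a : n.-tuple 'I_n) (s : seq 'I_n) (j j' c : 'I_n) :
  uniq s -> street_after a s j = Some c -> street_after a s j' = Some c -> j = j'.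
Proof.
elim/last_ind: s => [|s i IH]; first by rewrite /street_after /= ffunE.
rewrite rcons_uniq !street_after_rcons => /andP[si us].
case: eqP => [e1 [<-]|_ sj]; case: eqP => [e2|_ sj'].
- by move: e2; rewrite e1 => -[].
- by move/street_after_mem: sj'; rewrite (negbTE si).
- by move=> -[ic]; move/street_after_mem: sj; rewrite -ic (negbTE si).
- exact: IH.
Qed.

Lemma parked_inj n (a : n.-tuple 'I_n) (j j' c : 'I_n) :
  parked a j = Some c -> parked a j' = Some c -> j = j'.
Proof. exact: street_after_inj (enum_uniq _). Qed.

(** There are as many cars as spaces and no car stands twice, so all cars are
    parked if and only if no space is free. *)
Lemma is_parking_functionE n (a : n.-tuple 'I_n) :
  is_parking_function a = (filled a == finset.setT).
Proof.
have oa : occupied (parked a) = filled a.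
  rewrite -[in RHS](tuple.map_tnth_enum a); exact: occupied_street_after.
rewrite -oa; apply/idP/eqP => [pa|oT].
  have f_inj := @space_of_inj n (Sub a pa).
  apply/finset.setP => j; rewrite !inE -(f_invF f_inj j).
  by have := space_ofP (Sub a pa : parking_function n) (invF f_inj j) => /= ->.
have full j : exists c, parked a j = Some c.
  move/finset.setP/(_ j): oT; rewrite !inE; case: (parked a j) => // c _.
  by exists c.
have g_inj : injective (fun j => odflt j (parked a j)).
  move=> j j' /=; have [c jc] := full j; have [c' jc'] := full j'.
  by rewrite jc jc' /= => cc; apply: (parked_inj jc); rewrite jc' cc.
apply/forallP => i; apply/existsP; exists (invF g_inj i); apply/eqP.
have [c jc] := full (invF g_inj i).
by have /= := f_invF g_inj i; rewrite jc /= => ->.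
Qed.

(** On a full street the last car stands in the only space that the previous
    cars left free. *)
Lemma last_car_space n (a : n.+1.-tuple 'I_n.+1) (k : 'I_n.+1) :
  is_parking_function a && (parked a k == Some ord_max) =
  (filled a == finset.setT) && (filled (take n a) == (finset.setT :\ k)%SET).
Proof.
rewrite is_parking_functionE; case: eqP => //= faT.
have ek : enum 'I_n.+1 = rcons (take n (enum 'I_n.+1)) ord_max.
  have sz : (n < size (enum 'I_n.+1))%N by rewrite size_enum_ord.
  rewrite -[LHS](@take_oversize _ n.+1) ?size_enum_ord// (take_nth ord_max)//.
  congr rcons; apply: val_inj; rewrite /= nth_enum_ord//.
set s := take n (enum 'I_n.+1) in ek *.
have oa : occupied (street_after a s) = filled (take n a).
  by rewrite occupied_street_after /s map_take tuple.map_tnth_enum.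
have fa : park_one (filled (take n a)) (tnth a ord_max) = finset.setT.
  rewrite -faT -[in RHS](tuple.map_tnth_enum a) ek map_rcons filled_rcons.
  by rewrite /s map_take tuple.map_tnth_enum.
have -> : parked a k = street_after a (rcons s ord_max) k by rewrite -ek.
rewrite street_after_rcons oa.
have -> : ((if [pick j | free_at (filled (take n a)) (tnth a ord_max) j] == Some k
    then Some ord_max else street_after a s k) == Some ord_max) =
    ([pick j | free_at (filled (take n a)) (tnth a ord_max) j] == Some k).
  case: ifP => _; first by rewrite eqxx.
  apply/eqP => /street_after_mem.
  have := enum_uniq 'I_n.+1; by rewrite ek rcons_uniq => /andP[/negbTE -> _].
move: fa; rewrite /park_one; case: pickP => [j /and3P[_ jU _] jUT|_ ->].
  have -> : filled (take n a) = (finset.setT :\ j)%SET by rewrite -jUT setU1K.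
  apply/eqP/eqP => [[->]//|/finset.setP/(_ k)].
  by rewrite !inE eqxx andbT => /negbFE/eqP ->.
by apply/esym/negbTE/eqP => /finset.setP/(_ k); rewrite !inE eqxx.
Qed.

Lemma card_parking_function n : #|{: parking_function n}| = (n.+1 ^ n.-1)%N.
Proof.
rewrite -fillings_setT card_sig; apply: eq_card => a.
by rewrite !inE is_parking_functionE.
Qed.

Lemma card_last_car n (k : 'I_n.+1) :
  #|[set a : parking_function n.+1 | space_of a ord_max == k]%SET| =
  (k.+1 * ('C(n, k) * (k.+1 ^ k.-1 * (n - k).+1 ^ (n - k).-1)))%N.
Proof.
rewrite -fillings_remove -{1}[k.+1]run_length_setT -card_filled_last ?inE//.
rewrite -(card_imset _ val_inj); apply: eq_card => a.
rewrite inE -last_car_space; apply/imsetP/andP => [[b]|[pa /eqP ak]].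
  rewrite inE => /eqP bk ->; split; first exact: valP.
  by rewrite -bk space_ofP.
exists (Sub a pa) => //; rewrite inE; apply/eqP/(@parked_inj _ a _ _ ord_max) => //.
exact: (space_ofP (Sub a pa : parking_function n.+1)).
Qed.

Lemma park_probE (R : realType) n (P : pred 'S_n) :
  park_prob R n (fun s => P s) =
  (#|[set a : parking_function n | P (parking_perm a)]%SET|%:R /
   (n.+1 ^ n.-1)%N%:R)%:E.
Proof.
rewrite /park_prob -[LHS]/(\sum_(s \in [set` P]) (park_pmf R s)%:E)%E.
rewrite -(@bigfs _ _ _ _ (index_enum 'S_n))//; last first.
- by move=> s _; rewrite mem_index_enum.
- exact: index_enum_uniq.
rewrite sumEFin; congr EFin.
rewrite /park_pmf -mulr_suml -natr_sum card_parking_function.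
congr (_%:R / _); rewrite -sum1_card.
rewrite (partition_big (@parking_perm n) P)/=; last by move=> a; rewrite inE.
apply: eq_bigr => s Ps; rewrite -sum1_card; apply: eq_bigl => a; rewrite !inE.
by case: eqP => [->|]; rewrite ?Ps ?andbF.
Qed.

Lemma last_posE n (a : parking_function n.+1) :
  last_pos (parking_perm a) = (space_of a ord_max).+1.
Proof. by rewrite /last_pos /parking_perm invgK permE. Qed.

Lemma park_prob_last_pos (R : realType) (n k : nat) : (k <= n)%N ->
  park_prob R n.+1 (fun s => last_pos s = k.+1) =
  ((k.+1 * ('C(n, k) * (k.+1 ^ k.-1 * (n - k).+1 ^ (n - k).-1)))%N%:R /
   (n.+2 ^ n)%N%:R)%:E.
Proof.
rewrite -ltnS => kn.
rewrite -[X in X%:R / _](card_last_car (Ordinal kn)).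
have -> : (fun s : 'S_n.+1 => last_pos s = k.+1) = (fun s => last_pos s == k.+1).
  by apply: funext => s; apply: propext; split=> [->//|/eqP].
rewrite park_probE; congr (_%:R / _)%:E; apply: eq_card => a.
by rewrite !inE last_posE eqSS.
Qed.

Local Open Scope classical_set_scope.
Local Open Scope ring_scope.

(** * Monotonicity and two bounds for the exponential *)

Lemma is_derive_ge0_le (R : realType) (f df : R -> R) (a b : R) : a <= b ->
  (forall x : R, is_derive x 1 f (df x)) ->
  (forall x, a <= x <= b -> 0 <= df x) -> f a <= f b.
Proof.
move=> ab fdf df0.
have [|c] := @MVT_segment _ f df a b ab (fun x _ => fdf x).
  apply: derivable_within_continuous => x _; exact: (@ex_derive _ _ _ _ _ _ _ (fdf x)).
rewrite in_itv /= => cab; rewrite -subr_ge0 => ->.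
by rewrite mulr_ge0 ?df0// subr_ge0.
Qed.

(** The derivative of sinh y - y, up to a factor 2, is (e^y - 1)^2 / e^y. With
    y = ln (1 + 1/k) this bound and [tanh_upper_bound] give the error term of
    Stirling's formula without any division inside a derivative. *)
Lemma sinh_lower_bound (R : realType) (y : R) : 0 <= y -> 2 * y <= expR y - expR (- y).
Proof.
move=> y0; rewrite -subr_ge0.
pose f := fun x : R => expR x - expR (- x) - 2 * x.
pose df := fun x : R => expR x + expR (- x) - 2.
have fdf (x : R) : is_derive x 1 f (df x).
  rewrite /f /df; apply: is_derive_eq; rewrite /GRing.scale /=; ring.
have -> : expR y - expR (- y) - 2 * y = f y by [].
rewrite (_ : 0 = f 0); last by rewrite /f oppr0 expR0; ring.
apply: (is_derive_ge0_le y0 fdf) => x _; rewrite /df expRN.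
have e0 := expR_gt0 x.
rewrite (_ : _ - 2 = (expR x - 1) ^+ 2 / expR x); last by field; rewrite gt_eqF.
by rewrite divr_ge0 ?sqr_ge0 ?ltW.
Qed.

(** That is tanh (y / 2) <= y / 2; the derivative 1 + (y - 1) e^y is
    nonnegative because 1 - y <= e^(-y). *)
Lemma tanh_upper_bound (R : realType) (y : R) : 0 <= y ->
  2 * (expR y - 1) <= y * (expR y + 1).
Proof.
move=> y0; rewrite -subr_ge0.
pose f := fun x : R => x * (expR x + 1) - 2 * (expR x - 1).
pose df := fun x : R => 1 + (x - 1) * expR x.
have fdf (x : R) : is_derive x 1 f (df x).
  rewrite /f /df; apply: is_derive_eq; rewrite /GRing.scale /=; ring.
rewrite -[X in _ <= X]/(f y) (_ : 0 = f 0); last by rewrite /f expR0; ring.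
apply: (is_derive_ge0_le y0 fdf) => x _; rewrite /df.
have := expR_ge1Dx (- x); rewrite expRN => h.
have e0 := expR_gt0 x.
have : (1 - x) * expR x <= 1.
  by rewrite -ler_pdivlMr// div1r.
lra.
Qed.

(** * Wallis' product *)

(** The antiderivative of sin^n that vanishes at 0; the recursion is integration
    by parts. With it Wallis' integrals need no integration theory. *)
Fixpoint sin_pow_primitive (R : realType) (n : nat) (x : R) : R :=
  match n with
  | 0 => x
  | 1 => 1 - cos x
  | m.+2 => (m.+1%:R * sin_pow_primitive m x - cos x * sin x ^+ m.+1) / m.+2%:R
  end.

Lemma is_derive_sin_pow_step (R : realType) (F : R -> R) (n : nat) (x : R) :
  is_derive x 1 F (sin x ^+ n) ->
  is_derive x 1 (fun z => (n.+1%:R * F z - cos z * sin z ^+ n.+1) / n.+2%:R)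
    (sin x ^+ n.+2).
Proof.
move=> IH.
have h := is_deriveZ n.+2%:R^-1 (is_deriveB (is_deriveZ n.+1%:R IH)
  (is_deriveM (is_derive_cos x) (is_deriveX n.+1 (is_derive_sin x)))).
move: h; set G := (X in is_derive _ _ X _) => h.
have <- : G = (fun z => (n.+1%:R * F z - cos z * sin z ^+ n.+1) / n.+2%:R).
  by apply: funext => z; rewrite /G !fctE mulrC.
apply: (is_derive_eq h); rewrite /GRing.scale /=.
transitivity (n.+2%:R^-1 * (n.+1%:R * sin x ^+ n + sin x ^+ n.+2 -
   (cos x) ^+ 2 * (n.+1%:R * sin x ^+ n))).
  by rewrite ?exprfctE !exprS; ring.
by rewrite cos2sin2 !exprS; field; rewrite -natrD pnatr_eq0.
Qed.

Lemma is_derive_sin_pow_primitive (R : realType) (n : nat) (x : R) :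
  is_derive x 1 (@sin_pow_primitive R n) (sin x ^+ n).
Proof.
suff: is_derive x 1 (@sin_pow_primitive R n) (sin x ^+ n) /\
      is_derive x 1 (@sin_pow_primitive R n.+1) (sin x ^+ n.+1) by case.
elim: n => [|n [IH IHS]]; split=> //.
- by rewrite expr0; exact: is_derive_id.
- rewrite /=; apply: is_derive_eq; rewrite expr1; ring.
- exact: is_derive_sin_pow_step.
Qed.

(** The integral of sin^n over the interval from 0 to pi / 2. *)
Definition wallis (R : realType) (n : nat) : R := sin_pow_primitive n (pi / 2).

(** The difference of the two antiderivatives has the derivative
    sin^n (1 - sin), nonnegative on the interval. *)
Lemma wallis_decr (R : realType) (n : nat) : wallis R n.+1 <= wallis R n.
Proof.
pose f x : R := sin_pow_primitive n x - sin_pow_primitive n.+1 x.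
pose df x : R := sin x ^+ n - sin x ^+ n.+1.
have fdf (x : R) : is_derive x 1 f (df x).
  exact: is_deriveB (is_derive_sin_pow_primitive n x) (is_derive_sin_pow_primitive n.+1 x).
have F0 m : sin_pow_primitive m 0 = 0 :> R.
  suff: sin_pow_primitive m 0 = 0 :> R /\ sin_pow_primitive m.+1 0 = 0 :> R by case.
  elim: m => [|m [IH IHS]]; first by rewrite /= cos0 subrr.
  by split=> //; rewrite /= IH sin0 expr0n !mulr0 subrr mul0r.
have p0 : 0 <= pi / 2 :> R by rewrite divr_ge0// pi_ge0.
rewrite -subr_ge0 -[X in _ <= X]/(f (pi / 2)) (_ : 0 = f 0); last first.
  by rewrite /f !F0 subrr.
apply: (is_derive_ge0_le p0 fdf) => x /andP[x0 xp].
have s0 : 0 <= sin x.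
  by apply: sin_ge0_pi; rewrite x0 (le_trans xp)// ler_pdivrMr// ler_peMr ?pi_ge0// ler1n.
by rewrite /df exprS -{1}[sin x ^+ n]mul1r -mulrBl mulr_ge0 ?exprn_ge0// subr_ge0 sin_le1.
Qed.

Lemma wallisSS (R : realType) (n : nat) :
  wallis R n.+2 = n.+1%:R / n.+2%:R * wallis R n.
Proof. by rewrite /wallis /= cos_pihalf mul0r subr0 mulrAC. Qed.

Definition central_binomial_ratio (R : realType) (n : nat) : R :=
  'C(n.*2, n)%:R / 4 ^+ n.

Lemma central_binomial_ratioS (R : realType) (n : nat) :
  central_binomial_ratio R n.+1 =
  n.*2.+1%:R / n.*2.+2%:R * central_binomial_ratio R n.
Proof.
have e : (n.+1 * 'C(n.*2.+2, n.+1) = n.*2.+1.*2 * 'C(n.*2, n))%N.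
  have h1 := mul_bin_diag n.*2.+2 n; have h2 := mul_bin_down n.*2.+1 n.
  rewrite (_ : n.*2.+1 - n = n.+1)%N /= in h2; last by rewrite -addnn; lia.
  apply/eqP; rewrite -(eqn_pmul2l (ltn0Sn n)); apply/eqP.
  rewrite /= in h1 h2; rewrite -h1 mulnCA -h2 -!muln2; ring.
rewrite /central_binomial_ratio doubleS exprS.
have /(congr1 (fun n => n%:R : R)) := e; rewrite !natrM.
rewrite -(mul2n n.*2.+1) natrM => e'.
have -> : n.*2.+2%:R = 2 * n.+1%:R :> R by rewrite -natrM mul2n doubleS.
have n0 : n.+1%:R != 0 :> R by [].
have -> : 'C(n.*2.+2, n.+1)%:R = 2 * n.*2.+1%:R / n.+1%:R * 'C(n.*2, n)%:R :> R.
  by apply: (mulfI n0); rewrite e'; field; rewrite nat1r.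
by field; rewrite nat1r n0 expf_neq0.

Qed.

Lemma wallis_even (R : realType) n :
  wallis R n.*2 = pi / 2 * central_binomial_ratio R n.
Proof.
elim: n => [|n IH]; first by rewrite /central_binomial_ratio bin0 expr0 divr1 mulr1.
by rewrite doubleS wallisSS IH central_binomial_ratioS mulrCA.
Qed.

Lemma central_binomial_ratio_gt0 (R : realType) n : 0 < central_binomial_ratio R n.
Proof.
by rewrite divr_gt0 ?exprn_gt0// ltr0n bin_gt0 -addnn leq_addr.
Qed.

Lemma wallis_odd (R : realType) n :
  wallis R n.*2.+1 = (n.*2.+1%:R * central_binomial_ratio R n)^-1.
Proof.
elim: n => [|n IH].
  by rewrite /central_binomial_ratio bin0 expr0 divr1 mulr1 invr1 /wallis /= cos_pihalf subr0.
rewrite doubleS wallisSS IH central_binomial_ratioS.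
have b0 := gt_eqF (central_binomial_ratio_gt0 R n).
by field; rewrite b0 nat1r -!natrD !pnatr_eq0.

Qed.

(** Wallis' product, from the inequalities between three consecutive integrals:
    the integral of index 2n + 1 lies between those of indices 2n + 2 and
    2n. *)
Lemma wallis_bounds (R : realType) n :
  pi / 2 * (n.*2.+1%:R / n.*2.+2%:R) <=
  (n.*2.+1%:R * central_binomial_ratio R n ^+ 2)^-1 <= pi / 2.
Proof.
have b0 := central_binomial_ratio_gt0 R n.
have := wallis_decr R n.*2; have := wallis_decr R n.*2.+1.
rewrite -doubleS !wallis_even wallis_odd central_binomial_ratioS => h1 h2.
rewrite expr2 mulrA invfM ler_pdivlMr// ler_pdivrMr// h2 andbT.
by rewrite doubleS -[leLHS]mulrA.
Qed.

(** * Stirling's formula for the masses k^k e^(-k) / k! *)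

(** The probability that a Poisson variable of mean k is equal to k. *)
Definition poisson_diag (R : realType) (k : nat) : R :=
  k%:R ^+ k / k`!%:R * expR (- k%:R).

Lemma poisson_diag_gt0 (R : realType) k : 0 < poisson_diag R k.
Proof.
rewrite mulr_gt0 ?expR_gt0// divr_gt0 ?ltr0n ?fact_gt0//.
by case: k => [|k]; rewrite ?expr0 ?exprn_gt0.
Qed.

Lemma poisson_diagSE (R : realType) k :
  poisson_diag R k.+1 = k.+1%:R ^+ k / k`!%:R * expR (- k.+1%:R).
Proof.
rewrite /poisson_diag factS natrM exprS invfM mulrACA divff// mul1r//.
Qed.

Lemma poisson_diagS (R : realType) k :
  poisson_diag R k.+1 = k.+1%:R ^+ k / k`!%:R * expR (- k%:R) / expR 1.
Proof.
rewrite /poisson_diag factS natrM exprS invfM mulrACA divff// mul1r.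
by rewrite -(natr1 k) opprD expRD -expRN !mulrA.
Qed.

(** For k > 0 this is (1 + 1/k)^k <= e. *)
Lemma poisson_diag_le (R : realType) k : poisson_diag R k.+1 <= poisson_diag R k.
Proof.
rewrite poisson_diagS /poisson_diag.
rewrite ler_pdivrMr ?expR_gt0// [leRHS]mulrAC ler_pM2r ?expR_gt0//.
rewrite [leRHS]mulrAC ler_pM2r ?invr_gt0 ?ltr0n ?fact_gt0//.
case: k => [|k]; first by rewrite !expr0 mul1r -expR0 ler_expR.
have k0 : 0 < k.+1%:R :> R by [].
have -> : expR 1 = expR (k.+1%:R^-1) ^+ k.+1 :> R.
  by rewrite -expRM_natr mulVf.
rewrite -exprMn lerXn2r ?nnegrE ?mulr_ge0 ?expR_ge0//.
rewrite -ler_pdivrMl// (le_trans _ (expR_ge1Dx _))//.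
by rewrite -(natr1 k.+1) mulrDr mulVf// mulr1 addrC.
Qed.

(** For k > 0 this is e <= (1 + 1/k)^(k+1). *)
Lemma poisson_diag_mul_le (R : realType) k :
  k%:R * poisson_diag R k <= k.+1%:R * poisson_diag R k.+1.
Proof.
rewrite poisson_diagS /poisson_diag !mulrA -!exprS.
rewrite ler_pdivlMr ?expR_gt0// [leLHS]mulrAC ler_pM2r ?expR_gt0//.
rewrite [leLHS]mulrAC ler_pM2r ?invr_gt0 ?ltr0n ?fact_gt0//.
rewrite -ler_pdivlMr ?expR_gt0// -expRN.
have k0 : 0 < k.+1%:R :> R by [].
have -> : expR (- 1) = expR (- k.+1%:R^-1) ^+ k.+1 :> R.
  by rewrite -expRM_natr mulNr mulVf.
rewrite -exprMn lerXn2r ?nnegrE ?mulr_ge0 ?expR_ge0//.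
rewrite -ler_pdivrMl// (le_trans _ (expR_ge1Dx _))//.
by rewrite -(ler_pM2l k0) mulVKf ?gt_eqF// mulrDr mulrN divff// mulr1 -natr1 addrK.
Qed.

Lemma poisson_diag_le1 (R : realType) k : poisson_diag R k <= 1.
Proof.
elim: k => [|k IH]; last exact: le_trans (poisson_diag_le R k) IH.
by rewrite /poisson_diag expr0 oppr0 expR0 !mulr1 invr1.
Qed.

(** Stirling's formula says that this tends to 1 / (2 pi); the square avoids
    square roots. *)
Definition stirling_seq (R : realType) (k : nat) : R := k%:R * poisson_diag R k ^+ 2.

Lemma stirling_seqS (R : realType) k : (0 < k)%N ->
  stirling_seq R k.+1 =
  stirling_seq R k * expR (ln (k.+1%:R / k%:R) * k.*2.+1%:R - 2).
Proof.
move=> k0; have kR : 0 < k%:R :> R by rewrite ltr0n.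
rewrite /stirling_seq poisson_diagS /poisson_diag expRB expRM_natr lnK ?posrE ?divr_gt0//.
have -> : expR 2 = expR 1 ^+ 2 :> R by rewrite -expRM_natr mul1r.
have -> : (k.+1%:R / k%:R) ^+ k.*2.+1 = k.+1%:R / k%:R * (k.+1%:R ^+ k / k%:R ^+ k) ^+ 2 :> R.
  by rewrite exprS -muln2 exprM expr_div_n.
have f0 : k`!%:R != 0 :> R by rewrite pnatr_eq0 -lt0n fact_gt0.
have e0 := gt_eqF (expR_gt0 (1 : R)); have x0 := gt_eqF kR.
have : k%:R ^+ k != 0 :> R by rewrite expf_neq0// x0.
move: (k%:R ^+ k) (k.+1%:R ^+ k) (expR (- k%:R)) => A B a A0.
by field; rewrite e0 x0 f0 A0.
Qed.

(** The logarithm of the ratio of consecutive terms of [stirling_seq] is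
    nonnegative and at most a telescoping difference; so the sequence increases
    and stays bounded. *)
Lemma ln_succ_ratio_bounds (R : realType) k : (0 < k)%N ->
  2 <= ln (k.+1%:R / k%:R) * k.*2.+1%:R :> R /\
  ln (k.+1%:R / k%:R) * k.*2.+1%:R - 2 <= (2 * k%:R)^-1 - (2 * k.+1%:R)^-1 :> R.
Proof.
move=> k0; have kR : 0 < k%:R :> R by rewrite ltr0n.
set y := ln _.
have ey : expR y = k.+1%:R / k%:R by rewrite lnK// posrE divr_gt0.
have y0 : 0 <= y by rewrite ln_ge0// ler_pdivlMr// mul1r ler_nat.
have kS : k.+1%:R = k%:R + 1 :> R by rewrite natr1.
have k2 : k.*2.+1%:R = 2 * k%:R + 1 :> R by rewrite -natr1 -mul2n natrM.
have h1 := tanh_upper_bound y0; have h2 := sinh_lower_bound y0.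
rewrite expRN ey kS in h1 h2; rewrite k2 kS.
have kn0 := gt_eqF kR.
have kS0 : k%:R + 1 != 0 :> R by rewrite natr1.
split.
  move: h1; rewrite -(ler_pM2r kR).
  rewrite (_ : 2 * _ * _ = 2); last by field; rewrite kn0.
  by rewrite (_ : y * _ * _ = y * (2 * k%:R + 1))//; field; rewrite kn0.
have p : 0 < (2 * k%:R + 1) / 2 :> R by lra.
move: h2; rewrite -(ler_pM2r p).
rewrite (_ : 2 * y * _ = y * (2 * k%:R + 1)); last by field.
rewrite (_ : _ * ((2 * k%:R + 1) / 2) = 2 + ((2 * k%:R)^-1 - (2 * (k%:R + 1))^-1)).
  lra.
by field; rewrite kn0 kS0.
Qed.

Lemma nondecreasing_stirling_seq (R : realType) : nondecreasing_seq (stirling_seq R).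
Proof.
apply/nondecreasing_seqP => -[|k].
  by rewrite /stirling_seq mul0r mulr_ge0// sqr_ge0.
rewrite [leRHS]stirling_seqS// ler_peMr//.
  by rewrite mulr_ge0// sqr_ge0.
rewrite -[leLHS]expR0 ler_expR subr_ge0; exact: (ln_succ_ratio_bounds R (ltn0Sn k)).1.
Qed.

Lemma stirling_seq_ub (R : realType) k :
  stirling_seq R k.+1 * expR ((2 * k.+1%:R)^-1) <= stirling_seq R 1 * expR (2^-1).
Proof.
elim: k => [|k]; first by rewrite mulr1.
(* The product of the term and exp (1 / (2k)) decreases. *)
apply: le_trans; rewrite (stirling_seqS R (ltn0Sn k)) -mulrA -expRD.
rewrite ler_wpM2l ?mulr_ge0 ?sqr_ge0// ler_expR.
rewrite -lerBrDr; exact: (ln_succ_ratio_bounds R (ltn0Sn k)).2.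
Qed.

(** This is where central binomial coefficients, hence Wallis' product, enter
    Stirling's formula. *)
Lemma poisson_diag_double (R : realType) n :
  poisson_diag R n.*2 = poisson_diag R n ^+ 2 / central_binomial_ratio R n.
Proof.
have nn : (n <= n.*2)%N by rewrite -addnn leq_addr.
have := bin_fact nn; rewrite -{2}addnn addnK => /(congr1 (fun x => x%:R : R)).
rewrite !natrM => e.
have f0 : n`!%:R != 0 :> R by rewrite pnatr_eq0 -lt0n fact_gt0.
have b0 : 'C(n.*2, n)%:R != 0 :> R by rewrite pnatr_eq0 -lt0n bin_gt0.
have e1 : n.*2%:R ^+ n.*2 = 4 ^+ n * (n%:R ^+ n) ^+ 2 :> R.
  rewrite -mul2n natrM exprMn; congr (_ * _); last by rewrite mulnC exprM.
  by rewrite exprM; congr (_ ^+ n); ring.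
have e2 : expR (- n.*2%:R) = expR (- n%:R) ^+ 2 :> R.
  by rewrite -expRM_natr -muln2 natrM mulNr.
have p0 : 4 ^+ n != 0 :> R by rewrite expf_neq0.
rewrite /poisson_diag /central_binomial_ratio -e e1 e2.
move: (n%:R ^+ n) (expR (- n%:R)) => A a.
by field; rewrite f0 b0 p0.
Qed.

Lemma cvg_invn (R : realType) : (n%:R^-1 : R) @[n --> \oo] --> (0 : R).
Proof. by rewrite -cvg_shiftS; exact: cvg_harmonic. Qed.

(** The sequence v increases and is bounded, so it has a limit L > 0. By
    Wallis' product v_(2n) / v_n^2 tends to 2 pi, whence L = 2 pi L^2. *)
Lemma stirling_seq_cvg (R : realType) : stirling_seq R @ \oo --> (2 * pi)^-1.
Proof.
have vcvg : cvgn (stirling_seq R).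
  apply: nondecreasing_is_cvgn; first exact: nondecreasing_stirling_seq.
  exists (stirling_seq R 1 * expR (2^-1)) => _ [[|k] _ <-].
    by rewrite /stirling_seq mul0r !mulr_ge0 ?sqr_ge0 ?expR_ge0.
  apply: le_trans (stirling_seq_ub R k); rewrite ler_peMr//.
    by rewrite mulr_ge0// sqr_ge0.
  by rewrite -[leLHS]expR0 ler_expR.
set L := limn (stirling_seq R) in vcvg *.
have vL : stirling_seq R @ \oo --> L by exact: vcvg.
have L0 : 0 < L.
  apply: lt_le_trans (nondecreasing_cvgn_le (@nondecreasing_stirling_seq R) vcvg 1%N).
  by rewrite /stirling_seq mul1r exprn_gt0 ?poisson_diag_gt0.
pose w n : R := (n.*2.+1%:R * central_binomial_ratio R n ^+ 2)^-1.
have wpi : w @ \oo --> pi / 2.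
  apply: (@squeeze_cvgr _ _ _ _ (fun n => pi / 2 * (n.*2.+1%:R / n.*2.+2%:R)) (cst (pi / 2))).
  - by apply: nearW => n; exact: wallis_bounds.
  - rewrite -[X in _ --> X]mulr1; apply: cvgM; first exact: cvg_cst.
    rewrite (_ : (fun n => _) = (fun n : nat => 1 - 2^-1 * n.+1%:R^-1 : R)).
      rewrite -[X in _ --> X]subr0; apply: cvgB; first exact: cvg_cst.
      rewrite -[X in _ --> X](mulr0 2^-1); apply: cvgM; first exact: cvg_cst.
      exact: cvg_harmonic.
    apply: funext => n.
    have e : n.*2.+2%:R = 2 * n.+1%:R :> R by rewrite -natrM mul2n doubleS.
    have -> : n.*2.+1%:R = 2 * n.+1%:R - 1 :> R by rewrite -e -(natr1 n.*2.+1) addrK.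
    by rewrite e; field; rewrite nat1r.
  - exact: cvg_cst.
(* Here w n is the Wallis quotient; the doubling formula reads
   v_(2n) = v_n^2 (4 + 2 / n) w_n. *)
have rec : \forall n \near \oo, stirling_seq R n.*2 =
    stirling_seq R n ^+ 2 * ((4 + 2 * n%:R^-1) * w n).
  near=> n; have n0 : n%:R != 0 :> R by rewrite pnatr_eq0 -lt0n; near: n; exact: nbhs_infty_gt.
  have e : n.*2%:R = 2 * n%:R :> R by rewrite -mul2n natrM.
  have e1 : n.*2.+1%:R = 2 * n%:R + 1 :> R by rewrite -natr1 e.
  have e2 : 2 * n%:R + 1 != 0 :> R by rewrite -e1.
  have b0 := gt_eqF (central_binomial_ratio_gt0 R n).
  rewrite /stirling_seq poisson_diag_double /w e e1; field.
  by rewrite n0 b0 e2.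
have h1 : stirling_seq R n.*2 @[n --> \oo] --> L.
  apply: (@cvg_comp _ _ _ double (stirling_seq R) _ \oo _ _ vL).
  apply/cvgnyPge => A; near=> n; rewrite -addnn; apply: leq_trans (leq_addr _ _).
  by near: n; exact: nbhs_infty_ge.
have h2 : stirling_seq R n.*2 @[n --> \oo] --> L ^+ 2 * ((4 + 2 * 0) * (pi / 2)).
  apply: (cvg_trans (near_eq_cvg _)); first by apply: filterS rec => n ->.
  apply: cvgM; first by rewrite expr2; apply: cvgM.
  apply: cvgM wpi; apply: cvgD; first exact: cvg_cst.
  by apply: cvgM; [exact: cvg_cst|exact: cvg_invn].
have E : L = L ^+ 2 * ((4 + 2 * 0) * (pi / 2)).
  exact: (cvg_unique (@norm_hausdorff _ _) h1 h2).
suff -> : (2 * pi)^-1 = L by [].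
have p0 := @pi_gt0 R.
have : L * (L * (2 * pi) - 1) = 0 by rewrite mulrBr mulr1 [X in _ - X]E; field.
move/eqP; rewrite mulf_eq0 gt_eqF//= subr_eq0 => /eqP e.
by apply: (mulIf (lt0r_neq0 (mulr_gt0 (ltr0Sn R 1) p0))); rewrite e mulVf// gt_eqF// mulr_gt0.
Unshelve. all: by end_near.
Qed.

(** * Limits at the two ends of the street *)

(** Here n = k + m + 1. Replacing the powers and factorials by Poisson masses
    costs no exponential factor, because (k + 1) + (m + 1) = n + 1. *)
Lemma park_prob_poisson_diag (R : realType) (k m : nat) :
  park_prob R (k + m).+1 [set s | last_pos s = k.+1] =
  (poisson_diag R k.+1 * poisson_diag R m.+1 / poisson_diag R (k + m).+2 *
   ((k + m).+2%N%:R / ((k + m).+1%N%:R * m.+1%:R)))%:E.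
Proof.
rewrite [LHS](park_prob_last_pos R (leq_addr m k)) addKn; congr EFin.
rewrite !poisson_diagSE factS.
have -> : expR (- (k + m).+2%N%:R) = expR (- k.+1%:R) * expR (- m.+1%:R) :> R.
  by rewrite -expRD -opprD -natrD addSn addnS.
have b := bin_fact (leq_addr m k); rewrite addKn in b.
have /(congr1 (fun x => x%:R : R)) := b; rewrite !natrM => {}b.
rewrite -b.
have -> : k.+1%:R * ('C(k + m, k)%:R * ((k.+1 ^ k.-1)%:R * (m.+1 ^ m.-1)%:R)) =
    'C(k + m, k)%:R * k.+1%:R ^+ k * m.+1%:R ^+ m / m.+1%:R :> R.
  have -> : k.+1%:R ^+ k = k.+1%:R * (k.+1 ^ k.-1)%:R :> R.
    by case: (k) => [|k']; rewrite ?expn0 ?expr0 ?mulr1// exprS natrX.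
  have -> : m.+1%:R ^+ m = m.+1%:R * (m.+1 ^ m.-1)%:R :> R.
    by case: (m) => [|m']; rewrite ?expn0 ?expr0 ?mulr1// exprS natrX.
  by field; rewrite nat1r.
rewrite natrX exprS.
have x0 := gt_eqF (expR_gt0 (- k.+1%:R : R)).
have y0 := gt_eqF (expR_gt0 (- m.+1%:R : R)).
have k0 : k`!%:R != 0 :> R by rewrite pnatr_eq0 -lt0n fact_gt0.
have m0 : m`!%:R != 0 :> R by rewrite pnatr_eq0 -lt0n fact_gt0.
have c0 : 'C(k + m, k)%:R != 0 :> R by rewrite pnatr_eq0 -lt0n bin_gt0 leq_addr.
have n0 : (k + m).+2%N%:R ^+ (k + m) != 0 :> R by rewrite expf_neq0.
have n1 : (k + m).+2%N%:R != 0 :> R by [].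
have n2 : (k + m).+1%N%:R != 0 :> R by [].
have n3 : m.+1%:R != 0 :> R by [].
move: (expR _) (expR _) x0 y0 => x y x0 y0.
move: ((k + m).+2%:R) n1 n0 => N n1; move: (N ^+ (k + m)) => Z n0.
move: (k`!%:R) (m`!%:R) k0 m0 ((k + m).+1%:R) n2 (m.+1%:R) n3 => K M k0 m0 N1 n2 m1 n3.
move: (k.+1%:R ^+ k) (m1 ^+ m) => *.
by field; rewrite x0 y0 k0 m0 n2 n3 n1 n0 c0.
Qed.

(** The ratio lies between n / (n + j) and 1, by the monotonicity of the masses
    and of their products with the index. *)
Lemma poisson_diag_shift_cvg (R : realType) (j : nat) :
  poisson_diag R (n + j) / poisson_diag R n @[n --> \oo] --> (1 : R).
Proof.
have dec n : poisson_diag R (n + j) <= poisson_diag R n.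
  elim: j => [|j IH]; first by rewrite addn0.
  by rewrite addnS (le_trans (poisson_diag_le R _)).
have inc n : n%:R * poisson_diag R n <= (n + j)%N%:R * poisson_diag R (n + j).
  elim: j {dec} => [|j IH]; first by rewrite addn0.
  by rewrite addnS (le_trans IH)// poisson_diag_mul_le.
apply: (@squeeze_cvgr _ _ _ _ (fun n => 1 - j%:R * n%:R^-1) (cst 1)).
- near=> n.
  have n0 : 0 < n%:R :> R by rewrite ltr0n; near: n; exact: nbhs_infty_gt.
  have u0 := poisson_diag_gt0 R n.
  rewrite ler_pdivrMr// mul1r dec andbT ler_pdivlMr//.
  have -> : (1 - j%:R * n%:R^-1) * poisson_diag R n =
    n%:R^-1 * (n%:R * poisson_diag R n - j%:R * poisson_diag R n).
    by field; rewrite gt_eqF.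
  rewrite ler_pdivrMl//.
  rewrite lerBlDr (le_trans (inc n))// natrD mulrDl lerD2l ler_wpM2l//.
- rewrite -[X in _ --> X](subr0 1); apply: cvgB; first exact: cvg_cst.
  rewrite -[X in _ --> X](mulr0 j%:R).
  by apply: cvgM; [exact: cvg_cst | exact: cvg_invn].
- exact: cvg_cst.
Unshelve. all: by end_near.
Qed.

Lemma poisson_diag_shift_cvgV (R : realType) (j : nat) :
  poisson_diag R n / poisson_diag R (n + j) @[n --> \oo] --> (1 : R).
Proof.
rewrite -invr1 (_ : (fun n => _) =
  (fun n => (poisson_diag R (n + j) / poisson_diag R n)^-1)); last first.
  by apply: funext => n; rewrite invf_div.
by apply: cvgV; [exact: oner_neq0 | exact: poisson_diag_shift_cvg].
Qed.

Lemma cvg_ratio_succ (R : realType) (j : nat) :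
  (n.+1 + j)%N%:R / n.+1%:R @[n --> \oo] --> (1 : R).
Proof.
rewrite (_ : (fun n => _) = (fun n : nat => 1 + j%:R * n.+1%:R^-1 : R)); last first.
  by apply: funext => n; rewrite natrD mulrDl divff.
rewrite -[X in _ --> X](addr0 1); apply: cvgD; first exact: cvg_cst.
rewrite -[X in _ --> X](mulr0 j%:R).
by apply: cvgM; [exact: cvg_cst | exact: cvg_harmonic].
Qed.

Lemma last_pos_borel_limit (R : realType) (m : nat) : (0 < m)%N ->
  fine (park_prob R n [set s : 'S_n | last_pos s = (n.+1 - m)%N])
    @[n --> \oo] --> (m%:R ^+ m.-1 * expR (- m%:R) / m`!%:R : R).
Proof.
case: m => // m _.
rewrite -(cvg_shiftn m.+1).
have -> : m.+1%:R ^+ m * expR (- m.+1%:R) / m.+1`!%:R =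
    1 * (poisson_diag R m.+1 * m.+1%:R^-1 * 1).
  rewrite mul1r mulr1 poisson_diagSE factS natrM invfM; ring.
rewrite (_ : (fun n => _) = (fun n =>
   poisson_diag R n.+1 / poisson_diag R (n.+1 + m.+1) *
   (poisson_diag R m.+1 * m.+1%:R^-1 * ((n.+1 + m.+1)%N%:R / (n + m).+1%N%:R)))); last first.
  apply: funext => n.
  have -> : ((n + m.+1).+1 - m.+1 = n.+1)%N by lia.
  rewrite addnS park_prob_poisson_diag /= addSn addnS [((n + m).+1%:R * m.+1%:R)^-1]invfM; ring.
apply: cvgM.
  by have := @poisson_diag_shift_cvgV R m.+1; rewrite -cvg_shiftS.
apply: cvgM; first exact: cvg_cst.
rewrite (_ : (fun n => _) = (fun n => ((n + m).+1 + 1)%N%:R / (n + m).+1%:R : R)); last first.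
  by apply: funext => n; rewrite addSn addnS addn1.
by have := @cvg_ratio_succ R 1; rewrite -(cvg_shiftn m).
Qed.

Lemma last_pos_fixed_asymp (R : realType) (k : nat) : (0 < k)%N ->
  asymp_equiv
    (fun n => fine (park_prob R n [set s : 'S_n | last_pos s = k]))
    (fun n => k%:R ^+ k * expR (- k%:R) / k`!%:R * n%:R^-1).
Proof.
case: k => // k _; rewrite /asymp_equiv -(cvg_shiftn k.+1).
rewrite (_ : (fun n => _) = (fun n =>
   poisson_diag R n.+1 / poisson_diag R (n.+1 + k.+1) *
   ((n.+1 + k.+1)%N%:R / n.+1%:R))); last first.
  apply: funext => n.
  have -> : k.+1%:R ^+ k.+1 * expR (- k.+1%:R) / k.+1`!%:R = poisson_diag R k.+1.
    by rewrite mulrAC.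
  rewrite (addnC n) addSn park_prob_poisson_diag /=.
  rewrite (_ : (n.+1 + k.+1 = (k + n).+2)%N); last by lia.
  have u0 := gt_eqF (poisson_diag_gt0 R k.+1).
  have v0 := gt_eqF (poisson_diag_gt0 R (k + n).+2).
  have n1 : (k + n).+1%:R != 0 :> R by [].
  have n2 : n.+1%:R != 0 :> R by [].
  move: ((k + n).+1%:R) ((k + n).+2%:R) (n.+1%:R) n1 n2 => A B C A0 C0.
  by field; rewrite A0 C0 u0 v0.
have h1 : poisson_diag R n.+1 / poisson_diag R (n.+1 + k.+1) @[n --> \oo] --> (1 : R).
  by have := @poisson_diag_shift_cvgV R k.+1; rewrite -cvg_shiftS.
by have := cvgM h1 (@cvg_ratio_succ R k.+1); rewrite mulr1; apply.
Qed.

(** * Asymptotics in the middle of the street *)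

Lemma sqrt_poisson_diag_cvg (R : realType) (K : nat -> nat) : K @ \oo --> \oo ->
  Num.sqrt (K n)%:R * poisson_diag R (K n) @[n --> \oo] --> Num.sqrt ((2 * pi)^-1 : R).
Proof.
move=> Koo.
rewrite (_ : (fun n => _) = (fun n => Num.sqrt (stirling_seq R (K n)))); last first.
  apply: funext => n; rewrite /stirling_seq sqrtrM// sqrtr_sqr ger0_norm//.
  exact/ltW/poisson_diag_gt0.
apply: (@cvg_comp _ _ _ (fun n => stirling_seq R (K n)) Num.sqrt _ _ _ _ (@sqrt_continuous R _)).
exact: (@cvg_comp _ _ _ K (stirling_seq R) _ \oo _ Koo (@stirling_seq_cvg R)).
Qed.

Lemma powR_three_halves (R : realType) (a : R) : 0 <= a ->
  a `^ (3 / 2) = a * Num.sqrt a.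
Proof.
move=> a0; rewrite (_ : 3 / 2 = 1 + 2^-1); last by field.
rewrite powRD; last by apply/implyP => /eqP; lra.
by rewrite powRr1// powR12_sqrt.
Qed.

Lemma cvgn_ge_linear (R : realType) (K : nat -> nat) (a : nat -> R) (a0 : R) :
  0 < a0 -> a @ \oo --> a0 ->
  (\forall n \near \oo, a n * n%:R <= (K n)%:R) -> K @ \oo --> \oo.
Proof.
move=> a0_gt0 acvg aK; apply/cvgnyPge => A; near=> n.
have n_gt : (2 * A%:R / a0) < n%:R by near: n; exact: nbhs_infty_gtr.
have an : a0 / 2 < a n.
  near: n; apply: (cvgr_gt a0) => //; lra.
have h : a n * n%:R <= (K n)%:R by near: n; exact: aK.
rewrite -(ler_nat R) (le_trans _ h)//.
rewrite ltr_pdivrMr// in n_gt.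
have n0 : 0 <= n%:R :> R by [].
have : a0 / 2 * n%:R <= a n * n%:R by rewrite ler_wpM2r// ltW.
lra.
Unshelve. all: by end_near.
Qed.

(** With k = c_n n and m = n + 1 - k, each factor u_j of the law is
    replaced by sqrt j u_j, which tends to 1 / sqrt (2 pi); what remains is an
    algebraic function of c_n and of r_n = m / (n + 1), with limits c and
    1 - c. *)
Lemma last_pos_linear_asymp (R : realType) (c : nat -> R) (c0 : R) :
  (forall n, c n * n%:R \is a Num.int) ->
  c n @[n --> \oo] --> c0 -> 0 < c0 -> c0 < 1 ->
  asymp_equiv
    (fun n => fine (park_prob R n [set s : 'S_n | (last_pos s)%:R = c n * n%:R]))
    (fun n => ((2 * pi * c0) `^ (1 / 2) * (1 - c0) `^ (3 / 2))^-1
              * (n%:R `^ (3 / 2))^-1).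
Proof.
move=> cint ccvg c0_gt0 c0_lt1.
pose K n := `|Num.floor (c n * n%:R)|%N.
pose M n := (n.+1 - K n)%N.
have cpos : \forall n \near \oo, 0 < c n by apply: (cvgr_gt c0).
have clt1 : \forall n \near \oo, c n < 1 by apply: (cvgr_lt c0).
have KE : \forall n \near \oo, (K n)%:R = c n * n%:R :> R.
  near=> n; have cn0 : 0 < c n by near: n.
  have h : 0 <= c n * n%:R by rewrite mulr_ge0// ltW.
  have fl0 : 0 <= Num.floor (c n * n%:R) by rewrite floor_ge0.
  by rewrite /K natr_absz ger0_norm// floorK.
have Kn : \forall n \near \oo, (0 < K n <= n)%N.
  near=> n; have cn0 : 0 < c n by near: n.
  have cn1 : c n < 1 by near: n.
  have n0 : 0 < n%:R :> R by rewrite ltr0n; near: n; exact: nbhs_infty_gt.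
  have e : (K n)%:R = c n * n%:R :> R by near: n.
  by rewrite -(ltr0n R) -(ler_nat R) e mulr_gt0//= ger_pMl// ltW.
have ME : \forall n \near \oo, (M n)%:R = n.+1%:R - c n * n%:R :> R.
  near=> n; have /andP[_ kn] : (0 < K n <= n)%N by near: n.
  by rewrite /M natrB ?(leqW kn)//; congr (_ - _); near: n.
have Koo : K @ \oo --> \oo.
  by apply: (cvgn_ge_linear c0_gt0 ccvg); apply: filterS KE => n ->.
have Moo : M @ \oo --> \oo.
  have c1 : 0 < 1 - c0 by rewrite subr_gt0.
  have acvg : (1 - c n) @[n --> \oo] --> 1 - c0 by apply: cvgB => //; exact: cvg_cst.
  apply: (cvgn_ge_linear c1 acvg); apply: filterS ME => n ->.
  rewrite -natr1 mulrBl mul1r; lra.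
have Noo : (fun n => n.+1) @ \oo --> \oo.
  apply/cvgnyPge => A; near=> n; apply: leqW; near: n; exact: nbhs_infty_ge.
pose r n : R := (M n)%:R / n.+1%:R.
have rcvg : r @ \oo --> 1 - c0.
  have : 1 - c n * (1 - n.+1%:R^-1) @[n --> \oo] --> 1 - c0 * (1 - 0).
    apply: cvgB; first exact: cvg_cst.
    apply: cvgM => //; apply: cvgB; [exact: cvg_cst | exact: cvg_harmonic].
  rewrite subr0 mulr1; apply: cvg_trans; apply: near_eq_cvg.
  apply: filterS ME => n e; rewrite /r e -natr1; field; rewrite natr1//.
set A := (2 * pi * c0) `^ (1 / 2) * (1 - c0) `^ (3 / 2).
have A0 : 0 < A by rewrite mulr_gt0// powR_gt0// ?subr_gt0// !mulr_gt0// pi_gt0.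
pose s k : R := Num.sqrt k%:R * poisson_diag R k.
(* Uses sqrt (K n) = sqrt (c n) sqrt n and sqrt (M n) = sqrt (r n) sqrt (n + 1). *)
have E : \forall n \near \oo,
    s (K n) * s (M n) / s n.+1 * (A * ((Num.sqrt (c n))^-1 * (r n * Num.sqrt (r n))^-1)) =
    fine (park_prob R n [set s : 'S_n | (last_pos s)%:R = c n * n%:R]) /
    (A^-1 * (n%:R `^ (3 / 2))^-1).
  near=> n.
  have /andP[k0 kn] : (0 < K n <= n)%N by near: n.
  have cn0 : 0 < c n by near: n.
  have eK : (K n)%:R = c n * n%:R :> R by near: n.
  have n0 : (0 < n)%N by rewrite (leq_trans k0).
  have [k Kk] : exists k, K n = k.+1 by exists (K n).-1; rewrite prednK.
  have [m Mm] : exists m, M n = m.+1 by exists (M n).-1; rewrite prednK// /M subn_gt0.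
  have nkm : n = (k + m).+1 by move: Mm; rewrite /M Kk; lia.
  have -> : [set s : 'S_n | (last_pos s)%:R = c n * n%:R] = [set s : 'S_n | last_pos s = k.+1].
    apply/seteqP; split=> t /=; rewrite -eK -Kk; last by move=> ->.
    by move/eqP; rewrite eqr_nat => /eqP.
  have -> : fine (park_prob R n [set s | last_pos s = k.+1]) =
      poisson_diag R (K n) * poisson_diag R (M n) / poisson_diag R n.+1 *
      (n.+1%:R / (n%:R * (M n)%:R)).
    rewrite Kk Mm; clear -nkm; subst n; by rewrite park_prob_poisson_diag.
  rewrite powR_three_halves// /s.
  have nR : 0 < n%:R :> R by rewrite ltr0n.
  have M0 : 0 < (M n)%:R :> R by rewrite Mm.
  have r0 : 0 < r n by rewrite divr_gt0.
  have eM : (M n)%:R = r n * n.+1%:R by rewrite /r divfK.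
  rewrite {1}eK {1 2}eM.
  rewrite (sqrtrM _ (ltW cn0)) (sqrtrM _ (ltW r0)).
  have h1 : Num.sqrt (c n) != 0 by rewrite gt_eqF ?sqrtr_gt0.
  have h2 : Num.sqrt (r n) != 0 by rewrite gt_eqF ?sqrtr_gt0.
  have h3 : Num.sqrt n.+1%:R != 0 :> R by rewrite gt_eqF ?sqrtr_gt0.
  have h4 : Num.sqrt n%:R != 0 :> R by rewrite gt_eqF ?sqrtr_gt0.
  have h5 := gt_eqF (poisson_diag_gt0 R n.+1).
  have h6 := gt_eqF r0; have h7 := gt_eqF nR.
  have h8 : n.+1%:R != 0 :> R by [].
  have h9 := gt_eqF A0.
  move: (Num.sqrt (c n)) (Num.sqrt (r n)) (Num.sqrt n.+1%:R) (Num.sqrt n%:R) h1 h2 h3 h4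
    => x1 x2 x3 x4 h1 h2 h3 h4.
  move: n.+1%:R h8 => x5 h8.
  by field; rewrite h1 h2 h3 h4 h5 h6 h7 h8 h9.
rewrite /asymp_equiv; apply: cvg_trans (near_eq_cvg E) _.
pose sigma : R := Num.sqrt ((2 * pi)^-1).
have pi0 : 0 < 2 * pi :> R by rewrite mulr_gt0// pi_gt0.
have sigma0 : sigma != 0 by rewrite gt_eqF ?sqrtr_gt0 ?invr_gt0.
have sc0 : Num.sqrt c0 != 0 by rewrite gt_eqF ?sqrtr_gt0.
have d0 : 0 < 1 - c0 by rewrite subr_gt0.
have sd0 : Num.sqrt (1 - c0) != 0 by rewrite gt_eqF ?sqrtr_gt0.
have -> : (1 : R) = sigma * sigma / sigma *
    (A * ((Num.sqrt c0)^-1 * ((1 - c0) * Num.sqrt (1 - c0))^-1)).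
  have -> : A = sigma^-1 * Num.sqrt c0 * ((1 - c0) * Num.sqrt (1 - c0)).
    rewrite /A powR_three_halves ?(ltW d0)// div1r powR12_sqrt ?mulr_ge0 ?pi_ge0 ?ltW//.
    by rewrite (sqrtrM _ (ltW pi0)) /sigma sqrtrV ?ltW// invrK.
  have d1 := gt_eqF d0.
  by field; rewrite sigma0 sc0 sd0 d1.
apply: cvgM.
  apply: cvgM; first by apply: cvgM; exact: sqrt_poisson_diag_cvg.
  by apply: cvgV => //; exact: sqrt_poisson_diag_cvg.
apply: cvgM; first exact: cvg_cst.
apply: cvgM.
  apply: cvgV => //.
  exact: (@cvg_comp _ _ _ c Num.sqrt _ _ _ ccvg (@sqrt_continuous R _)).
apply: cvgV; first by rewrite mulf_neq0// gt_eqF.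
apply: cvgM => //.
exact: (@cvg_comp _ _ _ r Num.sqrt _ _ _ rcvg (@sqrt_continuous R _)).
Unshelve. all: by end_near.
Qed.

(** * The Borel masses sum to 1 *)

(** At 0 the inverse of 0 is 0, so that the mass there vanishes. *)
Definition borel_pmf (R : realType) (m : nat) : R := poisson_diag R m / m%:R.

Lemma borel_pmf0 (R : realType) : borel_pmf R 0 = 0.
Proof. by rewrite /borel_pmf invr0 mulr0. Qed.

Lemma borel_pmf_ge0 (R : realType) m : 0 <= borel_pmf R m.
Proof. by rewrite divr_ge0// ltW ?poisson_diag_gt0. Qed.

Lemma borel_pmfE (R : realType) m : (0 < m)%N ->
  borel_pmf R m = m%:R ^+ m.-1 * expR (- m%:R) / m`!%:R.
Proof.
by case: m => // m _; rewrite /borel_pmf poisson_diagSE factS natrM invfM; ring.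
Qed.

Lemma poisson_diag0 (R : realType) : poisson_diag R 0 = 1.
Proof. by rewrite /poisson_diag expr0 oppr0 expR0 invr1 !mulr1. Qed.

Lemma sum_park_prob_last_pos (R : realType) n :
  \sum_(k < n.+1) fine (park_prob R n.+1 [set s | last_pos s = k.+1]) = 1.
Proof.
have e : (\sum_(k < n.+1) k.+1 * ('C(n, k) * (k.+1 ^ k.-1 * (n - k).+1 ^ (n - k).-1)) =
    n.+2 ^ n)%N.
  rewrite -abel_identity; apply: eq_bigr => k _.
  rewrite mulnCA; congr muln; rewrite mulnA; congr muln.
  by case: (nat_of_ord k) => [|k'] //=; rewrite expnS.
have n0 : (n.+2 ^ n)%N%:R != 0 :> R by rewrite pnatr_eq0 expn_eq0.
rewrite -(divff n0) -[in X in _ = X / _]e natr_sum mulr_suml; apply: eq_bigr => k _.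
have kn : (k <= n)%N by rewrite -ltnS.
by rewrite [X in fine X](park_prob_last_pos R kn).
Qed.

(** For N >= 2 the terms with 0 < m < N add up to u_N (N - 1) / N, because the
    law of the space of the last car, for N - 1 cars, has total mass 1; the
    term m = N is the missing u_N / N. *)
Lemma renewal (R : realType) N : (0 < N)%N ->
  poisson_diag R N = \sum_(m < N.+1) borel_pmf R m * poisson_diag R (N - m).
Proof.
case: N => // -[|n] _.
  by rewrite !big_ord_recl big_ord0 /= borel_pmf0 /borel_pmf /bump /= subnn poisson_diag0; field.
have := sum_park_prob_last_pos R n.
rewrite (reindex_inj rev_ord_inj) /= => h.
rewrite big_ord_recl /= borel_pmf0 mul0r add0r big_ord_recr /= /bump /= !add1n subnn.
rewrite poisson_diag0 mulr1.
have v0 := poisson_diag_gt0 R n.+2.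
transitivity (poisson_diag R n.+2 * (n.+1%:R / n.+2%:R) + borel_pmf R n.+2).
  by rewrite /borel_pmf; field; rewrite -natrD pnatr_eq0.
congr (_ + _); rewrite -[LHS]mulr1 -[X in _ * X = _]h mulr_sumr.
apply: eq_bigr => i _; rewrite !add1n !subSS.
have il : (i <= n)%N by rewrite -ltnS.
have := @park_prob_poisson_diag R (n - i) i; rewrite subnK// subSn// => -> /=.
rewrite /borel_pmf.
have n1 : n.+1%:R != 0 :> R by [].
have n2 : n.+2%:R != 0 :> R by [].
have i1 : i.+1%:R != 0 :> R by [].
move: (n.+1%:R) (n.+2%:R) (i.+1%:R) n1 n2 i1 => A B C A0 B0 C0.
by field; rewrite A0 B0 C0 gt_eqF.
Qed.

(** The renewal equation summed over N, sorted by m. *)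
Lemma renewal_sum (R : realType) M :
  \sum_(N < M.+1) poisson_diag R N =
  1 + \sum_(m < M.+1) borel_pmf R m * \sum_(N < (M - m).+1) poisson_diag R N.
Proof.
elim: M => [|M IH].
  by rewrite !big_ord_recl !big_ord0 /= borel_pmf0 poisson_diag0 mul0r !addr0.
rewrite big_ord_recr IH /= [X in _ + X]renewal// -addrA; congr (1 + _).
rewrite [RHS](_ : _ = \sum_(m < M.+2) (borel_pmf R m * \sum_(N < M.+1 - m) poisson_diag R N +
    borel_pmf R m * poisson_diag R (M.+1 - m))).
  rewrite big_split /=; congr (_ + _).
  rewrite [RHS]big_ord_recr /= subnn big_ord0 mulr0 addr0.
  by apply: eq_bigr => m _; rewrite subSn// -ltnS.
by apply: eq_bigr => m _; rewrite -mulrDr big_ord_recr.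
Qed.

(** The terms dominate those of a multiple of the harmonic series, because
    k u_k increases. *)
Lemma poisson_diag_sum_cvgy (R : realType) :
  \sum_(N < M) poisson_diag R N @[M --> \oo] --> +oo.
Proof.
have harm : series (@harmonic R) @ \oo --> +oo.
  apply: nondecreasing_dvgn_lt; last exact: dvg_harmonic.
  by apply: nondecreasing_series => n _ _; exact: harmonic_ge0.
have lb k : expR (- 1) * harmonic k <= poisson_diag R k.+1.
  rewrite /= ler_pdivrMr// mulrC.
  elim: k => [|k IH]; last exact: le_trans IH (poisson_diag_mul_le R _).
  by rewrite mul1r /poisson_diag expr1 divff// mul1r.
have lbs M : expR (- 1) * series harmonic M <= \sum_(N < M.+1) poisson_diag R N.
  rewrite big_ord_recl /= (le_trans _ (_ : \sum_(i < M) poisson_diag R i.+1 <= _))//.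
    rewrite /series /= big_mkord mulr_sumr; apply: ler_sum => i _; exact: lb.
  by rewrite lerDr ltW ?poisson_diag_gt0.
rewrite -cvg_shiftS; apply/cvgryPge => A; near=> M.
rewrite (le_trans _ (lbs M))// -ler_pdivrMl ?expR_gt0//.
by near: M; move/cvgryPge : harm; apply.
Unshelve. all: by end_near.
Qed.

Lemma ler_poisson_diag_sum (R : realType) a b : (a <= b)%N ->
  \sum_(N < a) poisson_diag R N <= \sum_(N < b) poisson_diag R N.
Proof.
move=> ab; rewrite -(subnKC ab) big_split_ord /= lerDl.
by apply: sumr_ge0 => i _; exact/ltW/poisson_diag_gt0.
Qed.

(** Let U_j be the sum of the first j + 1 masses u and B the sum of the b_m with
    m <= M. Then 1 + B U_j <= U_(M+j) <= U_j + M, where the second bound uses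
    u <= 1; as U_j is unbounded, B <= 1. *)
Lemma sum_borel_pmf_le1 (R : realType) M : \sum_(m < M) borel_pmf R m <= 1.
Proof.
case: M => [|M]; first by rewrite big_ord0.
rewrite leNgt; apply/negP => B1; set B := \sum_(_ < _) _ in B1.
have key j : (B - 1) * \sum_(N < j.+1) poisson_diag R N <= M%:R.
  have ub : \sum_(N < (M + j).+1) poisson_diag R N <=
      \sum_(N < j.+1) poisson_diag R N + M%:R.
    rewrite (_ : (M + j).+1 = j.+1 + M)%N; last by lia.
    rewrite big_split_ord /= lerD2l -[leRHS]mulr_natr mul1r -[in leRHS](card_ord M).
    rewrite -sumr_const; apply: ler_sum => i _; exact: poisson_diag_le1.
  have lb : 1 + B * \sum_(N < j.+1) poisson_diag R N <=
      \sum_(N < (M + j).+1) poisson_diag R N.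
    rewrite [leRHS]renewal_sum lerD2l -addSn big_split_ord /= -[leLHS]addr0 lerD//.
      rewrite /B mulr_suml; apply: ler_sum => i _.
      rewrite ler_wpM2l ?borel_pmf_ge0// ler_poisson_diag_sum//.
      by have := ltn_ord i; lia.
    apply: sumr_ge0 => i _; rewrite mulr_ge0 ?borel_pmf_ge0//.
    by apply: sumr_ge0 => k _; exact/ltW/poisson_diag_gt0.
  lra.
have B0 : 0 < B - 1 by rewrite subr_gt0.
have /cvgryPgt/(_ (M%:R / (B - 1))) := @poisson_diag_sum_cvgy R.
move=> -[j _ /(_ j.+1 (leqnSn j))] /=.
by rewrite ltNge ler_pdivlMr// mulrC key.
Qed.

(** If U and B are the sums of the u_N and of the b_m up to the same index, then
    U <= 1 + B U, so 1 - B <= 1 / U, which tends to 0. *)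
Lemma borel_pmf_sum_cvg1 (R : realType) :
  \sum_(m < M) borel_pmf R m @[M --> \oo] --> (1 : R).
Proof.
rewrite -cvg_shiftS; apply/cvgrPdist_le => e e0.
have := @poisson_diag_sum_cvgy R; rewrite -cvg_shiftS => /cvgryPge/(_ e^-1).
apply: filterS => M /= UM.
rewrite ger0_norm ?subr_ge0 ?sum_borel_pmf_le1//.
set U := \sum_(_ < _) _ in UM; set B := \sum_(_ < _) _.
have U0 : 0 < U by apply: lt_le_trans UM; rewrite invr_gt0.
have : U <= 1 + B * U.
  rewrite {1}/U renewal_sum lerD2l mulr_suml; apply: ler_sum => i _.
  by rewrite ler_wpM2l ?borel_pmf_ge0// ler_poisson_diag_sum// ltnS leq_subr.
have : 1 <= e * U by rewrite -ler_pdivrMl// mulr1.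
move=> h1 h2; rewrite -(ler_pM2r U0) mulrBl mul1r; lra.
Qed.

(** * The Borel distribution and convergence in distribution *)

Definition borel_prob (R : realType) (A : set nat) : \bar R :=
  (\esum_(m in A) (borel_pmf R m)%:E)%E.
Arguments borel_prob : clear implicits.

Lemma borel_prob0 (R : realType) : borel_prob R set0 = 0%E.
Proof. exact: esum_set0. Qed.

Lemma borel_prob_ge0 (R : realType) (A : set nat) : (0 <= borel_prob R A)%E.
Proof. by apply: esum_ge0 => m _; rewrite lee_fin borel_pmf_ge0. Qed.

Lemma borel_prob_sigma_additive (R : realType) : semi_sigma_additive (borel_prob R).
Proof.
move=> F mF tF mUF; rewrite /borel_prob; apply: cvg_toP.
  apply: ereal_nondecreasing_is_cvgn => a b ab.
  by apply: lee_sum_nneg_natr => // n _ _; exact: borel_prob_ge0.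
by rewrite nneseries_sum_bigcup// => i; rewrite lee_fin borel_pmf_ge0.
Qed.

HB.instance Definition _ (R : realType) := isMeasure.Build _ _ _ (borel_prob R)
  (borel_prob0 R) (@borel_prob_ge0 R) (@borel_prob_sigma_additive R).

Lemma borel_prob_setT (R : realType) : borel_prob R [set: nat] = 1%E.
Proof.
rewrite /borel_prob -nneseries_esumT; last by move=> m; rewrite lee_fin borel_pmf_ge0.
apply: cvg_lim => //.
rewrite (_ : (fun n => _) = EFin \o (fun M => \sum_(m < M) borel_pmf R m)); last first.
  by apply: funext => M; rewrite /= big_mkord sumEFin.
apply: cvg_EFin; first exact: nearW.
exact: borel_pmf_sum_cvg1.
Qed.

HB.instance Definition _ (R : realType) :=
  @Measure_isProbability.Build _ _ R (borel_prob R) (borel_prob_setT R).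

Definition nat_embedding (R : realType) (m : nat) : R := m%:R.

Lemma measurable_nat_embedding (R : realType) :
  measurable_fun [set: nat] (@nat_embedding R).
Proof. by []. Qed.

HB.instance Definition _ (R : realType) :=
  isMeasurableFun.Build _ _ _ _ (@nat_embedding R) (@measurable_nat_embedding R).

Definition borel_RV (R : realType) : {RV (borel_prob R) >-> R} := @nat_embedding R.

Lemma borel_RV_eq (R : realType) (m : nat) :
  borel_prob R (@borel_RV R @^-1` [set m%:R]) = (borel_pmf R m)%:E.
Proof.
have -> : @borel_RV R @^-1` [set m%:R] = [set m].
  apply/seteqP; split=> k /=; rewrite /borel_RV /nat_embedding /=; last by move=> ->.
  by move/eqP; rewrite eqr_nat => /eqP.
by rewrite /borel_prob esum_set1// lee_fin borel_pmf_ge0.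
Qed.

Lemma borel_RV_has_borel_distribution (R : realType) :
  has_borel_distribution (@borel_RV R).
Proof.
split=> [|m m0]; last first.
  by rewrite [LHS]borel_RV_eq borel_pmfE// mulrA [expR _ * _]mulrC.
rewrite -(borel_prob_setT R).
have -> : [set: nat] = [set 0%N] `|` (@borel_RV R @^-1` [set m%:R | m in [set m | (0 < m)%N]]).
  apply/seteqP; split=> // -[|m] _; [by left | right].
  by exists m.+1.
rewrite measureU//; last first.
  apply/seteqP; split=> // k [/= -> [m m0]]; rewrite /borel_RV /nat_embedding /=.
  by move/eqP; rewrite eqr_nat => /eqP m00; rewrite m00 in m0.
rewrite [X in _ = (X + _)%E](_ : _ = 0%E) ?add0e//.
by rewrite [LHS]esum_set1 ?borel_pmf0.
Qed.

Definition count_le (R : realType) (x : R) : nat :=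
  if 0 <= x then (Num.truncn x).+1 else 0%N.

Lemma ltn_count_le (R : realType) (x : R) (i : nat) :
  (i < count_le x)%N = (i%:R <= x).
Proof.
rewrite /count_le; case: ifPn => [x0|]; first by rewrite ltnS truncn_ge_nat.
by rewrite -ltNge => x0; apply/esym/negbTE; rewrite -ltNge (lt_le_trans x0).
Qed.

Lemma cdf_nat_valued (R : realType) (d : measure_display) (Om : measurableType d)
    (P : probability Om R) (X : {RV P >-> R}) (x : R) :
  (forall w, exists k : nat, X w = k%:R) ->
  cdf X x = (\sum_(i < count_le x) P (X @^-1` [set i%:R]))%E.
Proof.
move=> Xnat; rewrite /cdf /distribution /pushforward.
rewrite -(measure_bigsetU P (F := fun i : nat => X @^-1` [set i%:R])).
- congr (P _); rewrite -(bigcup_mkord _ (fun i : nat => X @^-1` [set i%:R])).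
  apply/seteqP; split=> w /=.
    rewrite in_itv /=; have [k Xk] := Xnat w; rewrite Xk => kx.
    by exists k => //=; rewrite ltn_count_le.
  by move=> [k /=]; rewrite ltn_count_le in_itv /= => kx ->.
- by move=> i; rewrite -[X @^-1` _]setTI; exact: measurable_funP.
- move=> i j _ _ [w /= [-> /eqP]]; by rewrite eqr_nat => /eqP.
Qed.

(** Point masses suffice: each value of a distribution function is a sum of
    finitely many of them, the same number for all variables. *)
Lemma cvg_in_distribution_nat_valued (R : realType)
    (d : nat -> measure_display) (Om : forall n, measurableType (d n))
    (P : forall n, probability (Om n) R) (X : forall n, {RV (P n) >-> R})
    (d' : measure_display) (Om' : measurableType d')
    (P' : probability Om' R) (X' : {RV P' >-> R}) :
  (forall n w, exists k : nat, X n w = k%:R) ->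
  (forall w, exists k : nat, X' w = k%:R) ->
  (forall i : nat, P n (X n @^-1` [set i%:R]) @[n --> \oo] --> P' (X' @^-1` [set i%:R])) ->
  cvg_in_distribution X X'.
Proof.
move=> Xnat Xnat' PX x _; rewrite cdf_nat_valued//.
under eq_fun do rewrite cdf_nat_valued//.
by apply: cvg_nnesum => i _ //; apply: nearW => n.
Qed.

Lemma last_pos_le (n : nat) (s : 'S_n) : (last_pos s <= n)%N.
Proof. by case: n s => [|n] s //=; exact: ltn_ord. Qed.

Lemma last_pos_rev_nat (R : realType) n (s : 'S_n) :
  last_pos_rev R s = (n.+1 - last_pos s)%N%:R.
Proof. by rewrite /last_pos_rev natrB// leqW// last_pos_le. Qed.

(** The mass at 0 is 0 for every n, since the last car never stands in space
    n + 1. *)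
Lemma last_pos_rev_RV_cvg (R : realType) (i : nat) :
  park_prob R n (last_pos_rev_RV R n @^-1` [set i%:R]) @[n --> \oo] --> (borel_pmf R i)%:E.
Proof.
have E : \forall n \near \oo, park_prob R n [set s | last_pos s = (n.+1 - i)%N] =
    park_prob R n (last_pos_rev_RV R n @^-1` [set i%:R]).
  near=> n; congr (park_prob R n _); apply/seteqP; split=> s /=;
    rewrite /last_pos_rev_RV /= last_pos_rev_nat.
    move=> ->; rewrite subKn// leqW//; near: n; exact: nbhs_infty_ge.
  move/eqP; rewrite eqr_nat => /eqP <-; rewrite subKn// leqW// last_pos_le//.
apply: cvg_trans (near_eq_cvg E) _.
case: i {E} => [|i].
  apply: cvg_near_cst; rewrite borel_pmf0; near=> n.
  rewrite (_ : [set _ | _] = set0) ?measure0//.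
  apply/seteqP; split=> s //= e; have := last_pos_le s; rewrite e subn0 ltnn//.
rewrite borel_pmfE//; apply/fine_cvgP; split; last exact: last_pos_borel_limit.
by apply: nearW => n; rewrite fin_num_measure.
Unshelve. all: by end_near.
Qed.

Theorem corollary6 (R : realType) :
  [/\ (forall m : nat, (0 < m)%N ->
         fine (park_prob R n [set s : 'S_n | last_pos s = (n.+1 - m)%N])
           @[n --> \oo] --> (m%:R ^+ m.-1 * expR (- m%:R) / m`!%:R : R))
      /\
      (exists (d : measure_display) (Om : measurableType d)
         (P : probability Om R) (X : {RV P >-> R}),
         has_borel_distribution X /\
         cvg_in_distribution (fun n => last_pos_rev_RV R n) X),
      (forall k : nat, (0 < k)%N ->
         asymp_equiv
           (fun n => fine (park_prob R n [set s : 'S_n | last_pos s = k]))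
           (fun n => k%:R ^+ k * expR (- k%:R) / k`!%:R * n%:R^-1))
    & (forall (c : nat -> R) (c0 : R),
         (forall n, c n * n%:R \is a Num.int) ->
         c n @[n --> \oo] --> c0 -> 0 < c0 -> c0 < 1 ->
         asymp_equiv
           (fun n =>
              fine (park_prob R n [set s : 'S_n | (last_pos s)%:R = c n * n%:R]))
           (fun n => ((2 * pi * c0) `^ (1 / 2) * (1 - c0) `^ (3 / 2))^-1
                     * (n%:R `^ (3 / 2))^-1))].
Proof.
split; [split | exact: last_pos_fixed_asymp | exact: last_pos_linear_asymp].
  exact: last_pos_borel_limit.
exists _, _, (borel_prob R), (borel_RV R); split.
  exact: borel_RV_has_borel_distribution.
apply: cvg_in_distribution_nat_valued => [n s|m|i].
- by exists (n.+1 - last_pos s)%N; exact: last_pos_rev_nat.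
- by exists m.
- rewrite [X in _ --> X]borel_RV_eq; exact: last_pos_rev_RV_cvg.
Qed.
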